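(* Fix $\lambda>0$ satisfying both $1+\lambda>\mu_t^4$ and $2(1+\lambda)>\mu_t^2\big(1+\sqrt{1+4\lambda}\big)$. Then Glauber dynamics for independent sets with activity $\lambda$ on the $n\times n$ grid takes time at least $e^{cn}$ to mix, for some constant $c=c(\lambda)>0$.
   Context: The $n\times n$ grid is the subgraph of $\mathbb{Z}^2$ induced by $\{0,\dots,n-1\}^2$ (free boundary). Its independent sets carry the Gibbs distribution $\pi(I)=\lambda^{|I|}/Z$. Glauber dynamics is the Markov chain with $P(I,I')=\frac{1}{2n}\min(1,\lambda^{|I'|-|I|})$ if $|I\triangle I'|=1$, $P(I,I)=1-\sum_{J\ne I}P(I,J)$, and $0$ otherwise. The Manhattan lattice $\vec{\mathbb{Z}}^2$ orients edges of $\mathbb{Z}^2$ parallel to the $x$-axis positively iff their $y$-coordinate is even, and edges parallel to the $y$-axis positively iff their $x$-coordinate is even. A taxi walk of length $m$ is an $m$-step oriented walk in $\vec{\mathbb{Z}}^2$ from the origin, never revisiting a vertex, never taking two left or two right turns in a row; with $c_m$ their number, $\mu_t=\lim_{m\to\infty}c_m^{1/m}$ is the taxi walk connective constant.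
   Formalization: Glauber dynamics is normalized by 1/(2n^2), twice the number of vertices of the n×n grid, instead of 1/(2n), since with 1/(2n) the holding probability at the empty set is 1−n/2<0 for n≥3 and the chain is not defined. *)

(* Defs.v *)
From HB Require Import structures.
From mathcomp Require Import all_boot all_order all_algebra.
From mathcomp Require Import all_classical all_reals all_analysis.

Set Implicit Arguments.
Unset Strict Implicit.
Unset Printing Implicit Defensive.

Import Order.TTheory GRing.Theory Num.Theory.
Import numFieldNormedType.Exports.

Local Open Scope ring_scope.

Definition Z2 : Type := (int * int)%type.

Definition Z2_adj (u v : Z2) : bool :=
  (absz (u.1 - v.1) + absz (u.2 - v.2) == 1)%N.

Definition manhattan_arc (u v : Z2) : bool :=
  (v == (u.1 + (-1) ^+ odd (absz u.2), u.2))
  || (v == (u.1, u.2 + (-1) ^+ odd (absz u.1))).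

(* A walk from the origin is encoded by its steps, so that the walks of a given
   length form a finite type: (false, s) is the step (+-1, 0) and (true, s) is
   the step (0, +-1), with negative sign when s is true. *)
Definition dir : Type := (bool * bool)%type.

Definition step (d : dir) : Z2 :=
  if d.1 then (0, (-1) ^+ d.2) else ((-1) ^+ d.2, 0).

Definition origin : Z2 := (0, 0).

Definition walk_vertices (s : seq dir) : seq Z2 :=
  scanl (fun v d => (v.1 + (step d).1, v.2 + (step d).2)) origin s.

Definition left_turn (d d' : dir) : bool :=
  step d' == (- (step d).2, (step d).1).

Definition right_turn (d d' : dir) : bool :=
  step d' == ((step d).2, - (step d).1).

(* "In a row" refers to turns made at two consecutive vertices of the walk. *)
Fixpoint no_repeated_turn (s : seq dir) : bool :=
  if s is a :: (b :: c :: _) as s' then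
    [&& ~~ (left_turn a b && left_turn b c),
        ~~ (right_turn a b && right_turn b c) & no_repeated_turn s']
  else true.

Definition taxi_walk (s : seq dir) : bool :=
  [&& path manhattan_arc origin (walk_vertices s),
      uniq (origin :: walk_vertices s) & no_repeated_turn s].

Definition taxi_count (m : nat) : nat :=
  #|[set s : m.-tuple dir | taxi_walk s]|.

Definition taxi_constant (R : realType) : R :=
  limn (fun m : nat => (taxi_count m)%:R `^ (m%:R^-1) : R).

Definition grid (n : nat) : finType := ('I_n * 'I_n)%type.

Definition grid_vertex (n : nat) (u : grid n) : Z2 :=
  ((u.1 : nat)%:Z, (u.2 : nat)%:Z).

Definition grid_adj (n : nat) : rel (grid n) :=
  fun u v => Z2_adj (grid_vertex u) (grid_vertex v).

Definition independent (V : finType) (e : rel V) (I : {set V}) : bool :=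
  [forall u in I, forall v in I, ~~ e u v].

Definition indset (V : finType) (e : rel V) : finType :=
  {I : {set V} | independent e I}.

Section HardCore.
Variables (R : realType) (V : finType) (e : rel V) (lambda : R).
Implicit Types I J : indset e.

Definition partition_function : R :=
  \sum_(I : indset e) lambda ^+ #|val I|.

Definition gibbs I : R := lambda ^+ #|val I| / partition_function.

Definition symdiff (A B : {set V}) : {set V} := (A :\: B) :|: (B :\: A).

(* The normalization is twice the number of vertices, that is 2 n ^ 2 on the
   n x n grid; with 2 n the diagonal entries could be negative. *)
Definition glauber_move I J : R :=
  if #|symdiff (val I) (val J)| == 1%N then
    (2 * #|V|%:R)^-1 *
      Num.min 1 (lambda ^ (#|val J|%:Z - #|val I|%:Z))
  else 0.

Definition glauber I J : R :=
  if I == J then 1 - \sum_(K : indset e | K != I) glauber_move I K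
  else glauber_move I J.

End HardCore.

Section MixingTime.
Variables (R : realType) (S : finType) (P : S -> S -> R) (pi : S -> R).

Fixpoint transition (t : nat) (x y : S) : R :=
  if t is t'.+1 then \sum_(z : S) P x z * transition t' z y
  else (x == y)%:R.

Definition tv_distance (mu nu : S -> R) : R :=
  2^-1 * \sum_(x : S) `|mu x - nu x|.

Definition worst_tv (t : nat) : R :=
  \big[Num.max/0]_(x : S) tv_distance (transition t x) pi.

(* The infimum is +oo if the chain never gets eps-close to pi. *)
Definition mixing_time (eps : R) : \bar R :=
  ereal_inf [set (t%:R)%:E | t in [set t : nat | worst_tv t <= eps]]%classic.

End MixingTime.

Definition grid_glauber_mixing_time (R : realType) (lambda : R) (n : nat) :
    \bar R :=
  mixing_time (glauber (e := @grid_adj n) lambda)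
    (gibbs (e := @grid_adj n) lambda) (1 / 4).

(* Main.v *)
(* A Peierls argument that never needs to decide which phase a configuration is in.
   Fix a parity b. Let A_b be the set of configurations in which some distance-two
   cluster of occupied cells of parity b joins the left side of the grid to the
   right side.

   A configuration on the outer boundary of A_b, as well as a configuration lying in
   neither A_0 nor A_1, has a long fault: a connected set K with connected complement,
   missing one of the two vertical sides, whose boundary edges all have vacant ends
   and an inner end of the same parity.

   Moving the part of the configuration inside K one step away from the missed side
   frees the x cells of K whose neighbour towards the missed side lies outside K,
   and these can be filled arbitrarily, a gain (1 + lambda)^x. What is lost is a hard-core
   configuration on a part of one column with a cells, of weight about theta^a with
   theta = (1 + sqrt (1 + 4 lambda)) / 2, where x >= a and the boundary of K has about
   4 x - 2 a edges. The shift does not create clusters crossing K, so it maps the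
   complement of A_b into itself. The boundary edges of K, read in order, form a taxi
   walk on the lattice of edge midpoints, so there are about mu^l contours of length l;
   since mu^2 theta < 1 + lambda and mu^4 < 1 + lambda, the outer boundary of A_b has
   weight exponentially small relative to the complement of A_b, and the configurations
   outside A_0 and A_1 have exponentially small weight.

   One of A_0, A_1 and their complements is then a bottleneck: if the complement of
   A_b has probability at most 1/2, take it; if A_b has probability in [1/4, 1/2],
   take A_b; one of these holds for some b. *)
Require Import Defs.
From HB Require Import structures.
From mathcomp Require Import all_boot all_order all_algebra.
From mathcomp Require Import boolp reals zify lra ring.

Set Implicit Arguments.
Unset Strict Implicit.
Unset Printing Implicit Defensive.

Import Order.TTheory GRing.Theory Num.Theory.

Local Open Scope ring_scope.

(** * Bottlenecks and Glauber dynamics *)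

Lemma sum_setC (R : zmodType) (S : finType) (f : S -> R) (A : {set S}) :
  \sum_(x in A) f x + \sum_(x in ~: A) f x = \sum_x f x.
Proof. by rewrite [RHS](bigID (mem A)) /=; congr (_ + _); apply: eq_bigl => x; rewrite inE. Qed.

Section Bottleneck.
Variables (R : realType) (S : finType) (P : S -> S -> R) (pi : S -> R).
Hypothesis P_ge0 : forall x y, 0 <= P x y.
Hypothesis P_sum : forall x, \sum_y P x y = 1.
Hypothesis pi_ge0 : forall x, 0 <= pi x.
Hypothesis pi_sum : \sum_x pi x = 1.
Hypothesis reversible : forall x y, pi x * P x y = pi y * P y x.

Definition flow (A : {set S}) : R := \sum_(x in A) \sum_(y in ~: A) pi x * P x y.

Lemma flowC A : flow (~: A) = flow A.
Proof.
rewrite /flow exchange_big /= setCK; apply: eq_bigr => x _; apply: eq_bigr => y _.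
exact: reversible.
Qed.

Lemma transition_ge0 t x y : 0 <= transition P t x y.
Proof.
elim: t x => [|t IH] x /=; first by rewrite ler0n.
by apply: sumr_ge0 => z _; rewrite mulr_ge0.
Qed.

Lemma transition_sum t x : \sum_y transition P t x y = 1.
Proof.
elim: t x => [|t IH] x /=.
  rewrite (bigD1 x) //= eqxx big1 ?addr0 // => y /negbTE.
  by rewrite eq_sym => ->.
rewrite exchange_big /= -[RHS](P_sum x); apply: eq_bigr => z _.
by rewrite -mulr_sumr IH mulr1.
Qed.

Lemma stationary y : \sum_x pi x * P x y = pi y.
Proof.
rewrite (eq_bigr (fun x => pi y * P y x)) => [|x _]; last exact: reversible.
by rewrite -mulr_sumr P_sum mulr1.
Qed.

Lemma flow_ge0 A : 0 <= flow A.
Proof. by apply: sumr_ge0 => x _; apply: sumr_ge0 => y _; rewrite mulr_ge0. Qed.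

(** By conditioning on the first step: steps out of [A] contribute at most [flow A] in total, and by
    stationarity the steps ending in [A] bring at most [pi z] to each [z], so the induction
    hypothesis applies to the rest. *)
Lemma leakage_le (A : {set S}) t :
  \sum_(x in A) pi x * (\sum_(y in ~: A) transition P t x y) <= t%:R * flow A.
Proof.
elim: t => [|t IH].
  rewrite mul0r big1 // => x xA; rewrite big1 ?mulr0 // => y; rewrite inE => yA /=.
  by case: eqP => // xy; rewrite -xy xA in yA.
pose E z := \sum_(y in ~: A) transition P t z y.
have E0 z : 0 <= E z by apply: sumr_ge0 => y _; exact: transition_ge0.
have E1 z : E z <= 1.
  rewrite -(transition_sum t z) [leRHS](bigID (mem (~: A))) /= lerDl.
  by apply: sumr_ge0 => y _; exact: transition_ge0.
have -> : \sum_(x in A) pi x * (\sum_(y in ~: A) transition P t.+1 x y) =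
    \sum_(x in A) \sum_z pi x * P x z * E z.
  apply: eq_bigr => x _ /=; rewrite exchange_big /= mulr_sumr; apply: eq_bigr => z _.
  by rewrite -mulr_sumr mulrA.
apply: (@le_trans _ _ (\sum_(x in A) (\sum_(z in A) pi x * P x z * E z
   + \sum_(z in ~: A) pi x * P x z))).
  apply: ler_sum => x _; rewrite (bigID (mem A)) /= lerD2l.
  rewrite [leRHS](eq_bigl (fun z => z \notin A)); last by move=> z; rewrite inE.
  by apply: ler_sum => z _; rewrite ler_piMr ?mulr_ge0.
rewrite big_split /= -natr1 mulrDl mul1r; apply: lerD => //.
apply: le_trans IH; rewrite exchange_big /=; apply: ler_sum => z _.
rewrite -mulr_suml -/(E z) ler_wpM2r // -[leRHS]stationary [leRHS](bigID (mem A)) /= lerDl.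
by apply: sumr_ge0 => x _; rewrite mulr_ge0.
Qed.

(** [A] and its complement show the same discrepancy, which makes up for the factor one half in the
    distance. *)
Lemma tv_ge (mu nu : S -> R) (A : {set S}) : \sum_x mu x = 1 -> \sum_x nu x = 1 ->
  \sum_(x in A) nu x - \sum_(x in A) mu x <= tv_distance mu nu.
Proof.
move=> hm hn; rewrite /tv_distance.
have e1 : \sum_(x in A) nu x + \sum_(x in ~: A) nu x = 1.
  by rewrite sum_setC.
have e2 : \sum_(x in A) mu x + \sum_(x in ~: A) mu x = 1.
  by rewrite sum_setC.
have h1 : \sum_(x in A) nu x - \sum_(x in A) mu x <= \sum_(x in A) `|mu x - nu x|.
  by rewrite -sumrB; apply: ler_sum => x _; rewrite distrC ler_norm.
have h2 : \sum_(x in ~: A) mu x - \sum_(x in ~: A) nu x <= \sum_(x in ~: A) `|mu x - nu x|.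
  by rewrite -sumrB; apply: ler_sum => x _; rewrite ler_norm.
have e3 : \sum_x `|mu x - nu x| =
   \sum_(x in A) `|mu x - nu x| + \sum_(x in ~: A) `|mu x - nu x|.
  by rewrite sum_setC.
rewrite e3; lra.
Qed.

Lemma tv_le_worst t x : tv_distance (transition P t x) pi <= worst_tv P pi t.
Proof. by rewrite /worst_tv; apply: (le_bigmax _ (fun x => tv_distance (transition P t x) pi)). Qed.

(** The complement of [A] has stationary mass at least 1/2, so a mixed chain started at any [x] in
    [A] is outside [A] with probability at least 1/4. Averaging over [A] contradicts a small
    leakage. *)
Lemma bottleneck (A : {set S}) t : \sum_(x in A) pi x <= 1 / 2 -> worst_tv P pi t <= 1 / 4 ->
  \sum_(x in A) pi x <= 4 * (t%:R * flow A).
Proof.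
move=> hA hw.
have piC : \sum_(x in A) pi x + \sum_(x in ~: A) pi x = 1.
  by rewrite sum_setC.
apply: (@le_trans _ _ (4 * \sum_(x in A) pi x * (\sum_(y in ~: A) transition P t x y))); last first.
  by rewrite ler_pM2l ?leakage_le.
rewrite mulr_sumr; apply: ler_sum => x _.
have := tv_ge (~: A) (transition_sum t x) pi_sum.
have := tv_le_worst t x; have := pi_ge0 x.
set T := \sum_(y in _) transition _ _ _ _ => p0 h1 h2.
have T4 : 1 / 4 <= T by lra.
by rewrite mulrCA ler_peMr //; lra.
Qed.

Definition outer (A : {set S}) : {set S} :=
  [set x | (x \notin A) && [exists y in A, P x y != 0]].

Lemma flow_outer A : flow (~: A) <= \sum_(x in outer A) pi x.
Proof.
rewrite /flow setCK (bigID (mem (outer A))) /= [X in _ + X]big1 ?addr0; last first.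
  move=> x /andP[]; rewrite !inE => -> /=; rewrite negb_exists => /forallP h.
  by apply: big1 => y yA; have := h y; rewrite yA /= negbK => /eqP ->; rewrite mulr0.
rewrite (eq_bigl (mem (outer A))); last first.
  by move=> x; rewrite /= !inE andb_idl // => /andP[].
apply: ler_sum => x _; rewrite -mulr_sumr ler_piMr //.
by rewrite -(P_sum x) [leRHS](bigID (mem A)) /= lerDl sumr_ge0.
Qed.

Lemma slow_mixing (A B : {set S}) (eps : R) (t : nat) :
  0 < \sum_(x in ~: A) pi x -> 0 < \sum_(x in ~: B) pi x ->
  \sum_(x in outer A) pi x <= eps * \sum_(x in ~: A) pi x ->
  \sum_(x in outer B) pi x <= eps * \sum_(x in ~: B) pi x ->
  \sum_(x in ~: (A :|: B)) pi x <= 1 / 2 ->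
  worst_tv P pi t <= 1 / 4 -> 1 <= 16 * (t%:R * eps).
Proof.
move=> hA hB oA oB hAB hw.
(* Any such [C] of mass at least 1/4 is enough: the bottleneck is [~: C] if that has mass at most
   1/2, and [C] otherwise. The worse case is [C], giving 1/4 <= 4 * t * eps, hence the constant
   16. *)
have main (C : {set S}) : 0 < \sum_(x in ~: C) pi x ->
  \sum_(x in outer C) pi x <= eps * \sum_(x in ~: C) pi x ->
  1 / 4 <= \sum_(x in C) pi x -> 1 <= 16 * (t%:R * eps).
  move=> hC oC h4.
  have piC : \sum_(x in C) pi x + \sum_(x in ~: C) pi x = 1.
    by rewrite sum_setC.
  have f := le_trans (flow_outer C) oC.
  have t0 : 0 <= t%:R :> R by rewrite ler0n.
  have f0 := flow_ge0 C.
  have eps0 : 0 <= eps.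
    by rewrite -(pmulr_lge0 _ hC); rewrite flowC in f; exact: le_trans f.
  have te0 : 0 <= t%:R * eps by rewrite mulr_ge0.
  case: (leP (\sum_(x in ~: C) pi x) (1 / 2)) => hC2.
    have h2 := bottleneck hC2 hw; have h1 := ler_wpM2l t0 f.
    have {}h2 : 1 * \sum_(x in ~: C) pi x <= 4 * (t%:R * eps) * \sum_(x in ~: C) pi x.
      by rewrite mul1r; apply: le_trans h2 _; rewrite -!mulrA ler_pM2l.
    rewrite ler_pM2r // in h2; lra.
  have hC3 : \sum_(x in C) pi x <= 1 / 2 by lra.
  have h2 := bottleneck hC3 hw; rewrite -flowC in h2.
  have h1 := ler_wpM2l t0 f; rewrite mulrA in h1.
  have h3 : t%:R * eps * \sum_(x in ~: C) pi x <= t%:R * eps.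
    rewrite ler_piMr //; have : 0 <= \sum_(x in C) pi x by apply: sumr_ge0.
    by lra.
  lra.
case: (leP (1 / 4) (\sum_(x in A) pi x)) => hA4; first exact: (main A).
case: (leP (1 / 4) (\sum_(x in B) pi x)) => hB4; first exact: (main B).
exfalso.
have : 1 <= \sum_(x in A) pi x + \sum_(x in B) pi x + \sum_(x in ~: (A :|: B)) pi x.
  rewrite -pi_sum [X in _ <= X + _ + _]big_mkcond [X in _ <= _ + X + _]big_mkcond
    [X in _ <= _ + X]big_mkcond -!big_split /=; apply: ler_sum => x _.
  by rewrite !inE; have := pi_ge0 x; case: (x \in A); case: (x \in B) => /=; lra.
lra.
Qed.

End Bottleneck.

(** * Glauber dynamics as a reversible Markov chain *)

Section Glauber.
Variables (R : realType) (V : finType) (e : rel V) (lambda : R).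
Hypothesis lambda_gt0 : 0 < lambda.
Local Notation S := (indset e).
Implicit Types I J : S.

Lemma symdiffC (A B : {set V}) : symdiff A B = symdiff B A.
Proof. by rewrite /symdiff setUC. Qed.

Lemma symdiffK (A B : {set V}) : symdiff A (symdiff A B) = B.
Proof. by apply/setP => x; rewrite !inE; case: (x \in A); case: (x \in B). Qed.

Lemma independent0 : independent e set0.
Proof. by apply/forall_inP => u; rewrite inE. Qed.

Definition empty_indset : S := Sub set0 independent0.

Lemma weight_gt0 I : 0 < lambda ^+ #|val I|.
Proof. by rewrite exprn_gt0. Qed.

Lemma partition_function_gt0 : 0 < partition_function e lambda.
Proof.
rewrite /partition_function (bigD1 empty_indset) //= ltr_pwDl ?exprn_gt0 //.
by apply: sumr_ge0 => I _; rewrite ltW ?weight_gt0.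
Qed.

Lemma gibbs_gt0 I : 0 < gibbs lambda I.
Proof. by rewrite divr_gt0 ?weight_gt0 ?partition_function_gt0. Qed.

Lemma gibbs_sum : \sum_(I : S) gibbs lambda I = 1 :> R.
Proof. by rewrite -mulr_suml divff // gt_eqF ?partition_function_gt0. Qed.

Lemma glauber_move_ge0 I J : 0 <= glauber_move lambda I J.
Proof.
rewrite /glauber_move; case: ifP => // _; rewrite mulr_ge0 ?invr_ge0 ?mulr_ge0 ?ler0n //.
by rewrite le_min ler01 exprz_ge0 // ltW.
Qed.

Lemma card_moves I : (#|[set J : S | #|symdiff (val I) (val J)| == 1%N]| <= #|V|)%N.
Proof.
rewrite -(card_imset _ val_inj) -cardsT.
apply: leq_trans (leq_imset_card (fun v => symdiff (val I) [set v]) (mem [set: V])).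
apply/subset_leq_card/subsetP => A /imsetP[J]; rewrite inE => /cards1P[v hv] ->.
by apply/imsetP; exists v; rewrite ?inE // -hv symdiffK.
Qed.

Lemma glauber_move_sum I : \sum_(K : S | K != I) glauber_move lambda I K <= 1 / 2.
Proof.
pose M := [set J : S | #|symdiff (val I) (val J)| == 1%N].
apply: (@le_trans _ _ (\sum_(K in M) (2 * #|V|%:R)^-1)).
  rewrite big_mkcond [leRHS]big_mkcond; apply: ler_sum => K _ /=.
  have v0 : 0 <= (2 * #|V|%:R)^-1 :> R by rewrite invr_ge0 mulr_ge0 ?ler0n.
  have -> : (K \in M) = (#|symdiff (val I) (val K)| == 1%N) by rewrite inE.
  rewrite /glauber_move; case: ifP => _; case: ifP => // _.
  by rewrite ler_piMr // ge_min lexx.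
rewrite sumr_const -[leLHS]mulr_natr.
case: (posnP #|V|) => [->|V0]; first by rewrite mulr0 invr0 mul0r; lra.
have V0' : 0 < #|V|%:R :> R by rewrite ltr0n.
rewrite ler_pdivrMl ?mulr_gt0 // mulrAC.
have : (#|M|%:R <= #|V|%:R :> R) by rewrite ler_nat card_moves.
lra.
Qed.

Lemma glauber_ge0 I J : 0 <= glauber lambda I J.
Proof.
rewrite /glauber; case: ifP => _; last exact: glauber_move_ge0.
by have := glauber_move_sum I; lra.
Qed.

Lemma glauber_sum I : \sum_J glauber lambda I J = 1.
Proof.
rewrite (bigD1 I) //= {1}/glauber eqxx.
rewrite [X in _ + X](eq_bigr (glauber_move lambda I)) ?subrK // => J.
by rewrite eq_sym /glauber => /negbTE ->.
Qed.

(** Detailed balance holds because [lambda ^+ a * min 1 (lambda ^ (b - a))] equals the symmetric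
    expression [min (lambda ^+ a) (lambda ^+ b)]. *)
Lemma glauber_reversible I J :
  gibbs lambda I * glauber lambda I J = gibbs lambda J * glauber lambda J I.
Proof.
rewrite /glauber eq_sym; case: eqP => [->//|_].
rewrite /glauber_move symdiffC; case: ifP => // _; last by rewrite !mulr0.
have F (w Z c m : R) : w / Z * (c * m) = c / Z * (w * m).
  by rewrite mulrACA [w * c]mulrC mulrACA.
rewrite /gibbs [LHS]F [RHS]F; congr (_ * _).
have l0 : lambda != 0 by rewrite gt_eqF.
have E (a b : nat) : lambda ^+ a * Num.min 1 (lambda ^ (b%:Z - a%:Z)) =
  Num.min (lambda ^+ a) (lambda ^+ b).
  rewrite minr_pMr ?exprn_ge0 ?(ltW lambda_gt0) // mulr1.
  by congr Num.min; rewrite !exprnP -expfzDr // subrKC.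
by rewrite !E minC.
Qed.

Lemma glauber_neq0 I J : I != J -> glauber lambda I J != 0 -> 
  #|symdiff (val I) (val J)| == 1%N.
Proof.
by rewrite /glauber => /negbTE ->; rewrite /glauber_move; case: ifP => //; rewrite eqxx.
Qed.

(* Started from the empty set the chain stays put with probability at least 1/2,
   whereas the empty set has probability at most [1 / (1 + lambda) < 1/4]. *)
Lemma not_mixed_early (v : V) t : 3 < lambda -> irreflexive e -> (t <= 1)%N ->
  1 / 4 < worst_tv (glauber (e := e) lambda) (gibbs (e := e) lambda) t.
Proof.
move=> l3 ie t1.
pose S0 := [set ~ empty_indset].
have Iv : independent e [set v].
  by apply/forall_inP => u /set1P ->; apply/forall_inP => w /set1P ->; rewrite ie.
pose Jv : S := Sub [set v] Iv.
have Z1 : 1 + lambda <= partition_function e lambda.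
  rewrite /partition_function (bigD1 empty_indset) //= (bigD1 Jv) /=; last first.
    by apply/eqP => /(congr1 val)/setP/(_ v); rewrite !inE eqxx.
  rewrite cards0 expr0 cards1 expr1 addrA lerDl sumr_ge0 // => I _.
  by rewrite ltW ?weight_gt0.
have g0 : gibbs lambda empty_indset < 1 / 4.
  rewrite /gibbs /= cards0 expr0 ltr_pdivrMr ?partition_function_gt0 //; lra.
have t0 : 1 / 2 <= transition (glauber (e := e) lambda) t empty_indset empty_indset.
  case: t t1 => [|[|//]] _ /=; first by rewrite eqxx /=; lra.
  rewrite (bigD1 empty_indset) //= eqxx mulr1 big1 ?addr0; last first.
    by move=> I /negbTE ->; rewrite mulr0.
  by rewrite /glauber eqxx; have := glauber_move_sum empty_indset; lra.
apply: lt_le_trans (tv_le_worst _ _ t empty_indset).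
have := tv_ge S0 (transition_sum glauber_sum t empty_indset) gibbs_sum.
apply: lt_le_trans.
have := sum_setC (gibbs (e := e) lambda) S0.
have := sum_setC (transition (glauber (e := e) lambda) t empty_indset) S0.
rewrite /S0 setCK !big_set1 gibbs_sum (transition_sum glauber_sum); lra.
Qed.

End Glauber.

(** * Oriented boundary edges of a set of cells *)

Definition mv (z : Z2) (d : dir) : Z2 := (z.1 + (step d).1, z.2 + (step d).2).
(** The quarter turn to the left, that is counterclockwise. *)
Definition drot (d : dir) : dir := (~~ d.1, d.1 (+) d.2).
Definition dopp (d : dir) : dir := (d.1, ~~ d.2).
Definition par (z : Z2) : bool := odd (absz (z.1 + z.2)).

Lemma mvE (z : Z2) (d : dir) : mv z d =
  match d with
  | (false, false) => (z.1 + 1, z.2)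
  | (false, true) => (z.1 - 1, z.2)
  | (true, false) => (z.1, z.2 + 1)
  | (true, true) => (z.1, z.2 - 1)
  end.
Proof. by case: d => [[] []]; rewrite /mv /step /= ?addr0. Qed.

Lemma Z2_eq (z w : Z2) : (z == w) = (z.1 == w.1) && (z.2 == w.2).
Proof. by case: z; case: w. Qed.

Ltac z2 := rewrite ?mvE /=; repeat (match goal with z : Z2 |- _ => destruct z end); rewrite /=;
  try (congr pair); try lia.

Lemma mv_dopp z d : mv (mv z d) (dopp d) = z.
Proof. by case: d => [[] []]; z2. Qed.

Lemma dopp_mv z d : mv (mv z (dopp d)) d = z.
Proof. by case: d => [[] []]; z2. Qed.

Lemma mvC z d e : mv (mv z d) e = mv (mv z e) d.
Proof. by case: d e => [[] []] [[] []]; z2. Qed.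

Lemma doppK : involutive dopp. Proof. by case=> [[] []]. Qed.
Lemma drot_drot d : drot (drot d) = dopp d. Proof. by case: d => [[] []]. Qed.
Lemma drot_dopp d : drot (dopp d) = dopp (drot d). Proof. by case: d => [[] []]. Qed.

Lemma par_mv z d : par (mv z d) = ~~ par z.
Proof. by rewrite mvE /par; case: d => [[] []] /=; lia. Qed.

Lemma mv_inj d : injective (mv^~ d).
Proof. by move=> z w /= h; rewrite -(mv_dopp z d) h mv_dopp. Qed.

Section Grid.
Variable n : nat.
Local Notation G := (grid n).
Implicit Types (K C J : {set G}) (z : Z2) (d : dir) (u v w : G).

Local Notation gv := (@grid_vertex n).

(** Membership is extended to all lattice points, so that neighbours can be taken without first
    checking that they lie on the grid. *)
Definition inz K z := [exists u in K, gv u == z].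

Lemma gv_inj : injective gv.
Proof. by move=> [a b] [c d] [] /ord_inj -> /ord_inj ->. Qed.

Lemma inz_gv K u : inz K (gv u) = (u \in K).
Proof.
apply/existsP/idP => [[v /andP[vK /eqP /gv_inj <-]]//|uK].
by exists u; rewrite uK eqxx.
Qed.

Lemma inzP K z : reflect (exists2 u, u \in K & gv u = z) (inz K z).
Proof.
apply: (iffP existsP) => [[u /andP[uK /eqP e]]|[u uK e]]; exists u => //.
by rewrite uK e eqxx.
Qed.

Definition box z := [&& 0 <= z.1, z.1 < n%:Z, 0 <= z.2 & z.2 < n%:Z].

Lemma box_gv u : box (gv u).
Proof. by case: u => [[a ha] [b hb]]; rewrite /box /= !ltz_nat ha hb. Qed.

Lemma boxP z : reflect (exists u, gv u = z) (box z).
Proof.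
apply: (iffP idP) => [|[u <-]]; last exact: box_gv.
case: z => a b /and4P[/= a0 an b0 bn].
have ha : (absz a < n)%N by lia.
have hb : (absz b < n)%N by lia.
by exists (Ordinal ha, Ordinal hb); rewrite /grid_vertex /=; congr pair; lia.
Qed.

Lemma inz_box K z : inz K z -> box z.
Proof. by case/inzP => u _ <-; exact: box_gv. Qed.

Lemma inzC K z : inz (~: K) z = box z && ~~ inz K z.
Proof.
case: boxP => [[u <-]|h] /=; first by rewrite !inz_gv inE.
by apply/negbTE/negP => /inzP[u _ e]; apply: h; exists u.
Qed.

Lemma adjP u v : reflect (exists d, gv v = mv (gv u) d) (grid_adj u v).
Proof.
apply: (iffP idP); rewrite /grid_adj /Z2_adj /=; last first.
  by case=> [[[] []]]; rewrite mvE => -[]; lia.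
case: u v => [a b] [c d] /=.
move=> h.
have [H|[H|[H|H]]] : (c%:Z = a%:Z + 1 /\ d%:Z = b%:Z) \/ (c%:Z = a%:Z - 1 /\ d%:Z = b%:Z) \/
  (c%:Z = a%:Z /\ d%:Z = b%:Z + 1) \/ (c%:Z = a%:Z /\ d%:Z = b%:Z - 1) by lia.
- by exists (false, false); rewrite mvE /grid_vertex /=; case: H => -> ->.
- by exists (false, true); rewrite mvE /grid_vertex /=; case: H => -> ->.
- by exists (true, false); rewrite mvE /grid_vertex /=; case: H => -> ->.
- by exists (true, true); rewrite mvE /grid_vertex /=; case: H => -> ->.
Qed.

Lemma box_sq z d : box (mv z d) -> box (mv z (drot d)) -> box (mv (mv z d) (drot d)).
Proof.
case: z => a b; rewrite !mvE /box.
by case: d => [[] []] /=; lia.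
Qed.

Lemma box_sq' z d : box z -> box (mv (mv z d) (drot d)) ->
  box (mv z d) && box (mv z (drot d)).
Proof.
case: z => a b; rewrite !mvE /box.
by case: d => [[] []] /=; lia.
Qed.

(** Inner ends of boundary edges share one colour of the chessboard. This lets a contour that turns
    at every step stay on the boundary, and follow the arcs of the Manhattan lattice. *)
Definition typed (b : bool) K := forall z d,
  inz K z -> box (mv z d) -> ~~ inz K (mv z d) -> par z = ~~ b.

Definition bdry K (e : Z2 * dir) := inz K e.1 && inz (~: K) (mv e.1 e.2).

(* The boundary edge [(u, d)] is crossed from [u] to [u + d]; its dual edge is followed
   with [u] on the left. Where two contours touch, [nxt] turns around the inner cell. *)
Definition nxt K (e : Z2 * dir) : Z2 * dir :=
  if inz K (mv e.1 (drot e.2)) then (mv (mv e.1 e.2) (drot e.2), dopp (drot e.2))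
  else (e.1, drot e.2).

Definition prv K (e : Z2 * dir) : Z2 * dir :=
  if inz K (mv e.1 (dopp (drot e.2))) then (mv (mv e.1 e.2) (dopp (drot e.2)), drot e.2)
  else (e.1, dopp (drot e.2)).

Lemma bdryE K z d : bdry K (z, d) = [&& inz K z, box (mv z d) & ~~ inz K (mv z d)].
Proof. by rewrite /bdry /= inzC. Qed.

Lemma prv_nxt K e : bdry K e -> prv K (nxt K e) = e.
Proof.
case: e => u d; rewrite bdryE => /and3P[uK _ vK].
rewrite /nxt /=; case: ifP => hK; rewrite /prv /=.
  rewrite drot_dopp drot_drot !doppK.
  by rewrite (mvC u d) mv_dopp hK (mvC _ (dopp _) (dopp _)) !mv_dopp.
by rewrite drot_drot !doppK (negbTE vK).
Qed.

Lemma nxt_prv K e : bdry K e -> nxt K (prv K e) = e.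
Proof.
case: e => u d; rewrite bdryE => /and3P[uK _ vK].
rewrite /prv /=; case: ifP => hK; rewrite /nxt /=.
  rewrite drot_drot !doppK.
  by rewrite (mvC u d) mv_dopp hK (mvC _ (drot d) (dopp d)) mv_dopp dopp_mv.
by rewrite drot_dopp drot_drot !doppK (negbTE vK).
Qed.

Lemma typed_core b K z d : typed b K -> inz K z -> par z = b -> box (mv z d) ->
  inz K (mv z d).
Proof.
move=> tK zK pz bz; apply: contraT => nK.
by have := tK _ _ zK bz nK; rewrite pz; case: (b).
Qed.

(** A contour can only stop at the border of the grid. If the cell next to [e.1] in direction
    [drot e.2] is in [K], it has parity [b], so all its grid neighbours are in [K], among them the
    diagonal cell to which [nxt] moves. *)
Lemma bdry_nxt b K e : typed b K -> bdry K e ->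
  bdry K (nxt K e) = box (mv e.1 (drot e.2)).
Proof.
case: e => u d tK; rewrite bdryE => /and3P[uK bv vK] /=.
have pu := tK _ _ uK bv vK.
rewrite /nxt /=; case: ifP => hK; last by rewrite bdryE uK hK /= andbT.
have bh := inz_box hK; rewrite bh bdryE mv_dopp bv vK !andbT.
rewrite mvC; apply: (typed_core tK hK); first by rewrite par_mv pu negbK.
by rewrite mvC; apply: box_sq.
Qed.

Definition gin K : rel G := fun u v => [&& grid_adj u v, u \in K & v \in K].
Definition conn K := forall u v, u \in K -> v \in K -> connect (gin K) u v.

Lemma connect_const (T : finType) (A : eqType) (e : rel T) (f : T -> A) :
  (forall x y, e x y -> f x = f y) -> forall x y, connect e x y -> f x = f y.
Proof.
move=> h x y /connectP[p pp ->]; elim: p x pp => //= a p IH x /andP[/h -> /IH //].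
Qed.

(** Discrete Poincare lemma modulo 2: an edge function with even sum around every unit square has a
    potential, obtained by summing along the bottom row and then up the column. *)
Lemma poincare (h v : nat -> nat -> bool) :
  (forall x y, (x.+1 < n)%N -> (y.+1 < n)%N ->
     h x y (+) v x.+1 y (+) h x y.+1 (+) v x y = false) ->
  exists k : nat -> nat -> bool,
   (forall x y, (x.+1 < n)%N -> (y < n)%N -> k x y (+) k x.+1 y = h x y) /\
   (forall x y, (x < n)%N -> (y.+1 < n)%N -> k x y (+) k x y.+1 = v x y).
Proof.
move=> hf.
pose k x y := \big[addb/false]_(i < x) h i 0%N (+) \big[addb/false]_(j < y) v x j.
have kv x y : k x y (+) k x y.+1 = v x y.
  rewrite /k [X in _ (+) (_ (+) X)]big_ord_recr /=.
  by case: (\big[_/_]_(i < x) _); case: (\big[_/_]_(i < y) _); case: (v x y).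
exists k; split=> x y hx hy; last exact: kv.
elim: y hy => [|y IH] hy.
  rewrite /k !big_ord0 [X in _ (+) (X (+) _)]big_ord_recr /=.
  by case: (\big[_/_]_(i < x) _); case: (h x 0%N).
have := hf x y hx hy; have := IH (ltnW hy); have := kv x y; have := kv x.+1 y.
case: (k x y) (k x.+1 y) (k x y.+1) (k x.+1 y.+1) => [] [] [] [];
case: (h x y) (v x y) (v x.+1 y) (h x y.+1) => [] [] [] [] //.
Qed.

End Grid.

(** * The boundary of a connected set with connected complement is one contour *)

Section Trace.
Variable n : nat.
Local Notation G := (grid n).
Local Notation gv := (@grid_vertex n).
Implicit Types (K C J : {set G}) (z : Z2) (d : dir) (u v w : G).
Variables (b : bool) (K : {set G}).
Hypothesis tK : typed b K.

Local Notation succ := (fun e e' => e' == nxt K e).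

Definition bdseq : seq (Z2 * dir) :=
  [seq e <- [seq (gv u, d) | u <- enum {: G}, d <- enum {: bool * bool}] | bdry K e].

Lemma mem_bdseq e : (e \in bdseq) = bdry K e.
Proof.
rewrite mem_filter andb_idr //; case: e => z d; rewrite /bdry /= => /andP[/inzP[u _ <-] _].
by apply: (@allpairs_f _ _ _ (fun u d => (gv u, d))); rewrite mem_enum.
Qed.

(** Take a longest duplicate-free [nxt]-path of boundary edges. An edge whose successor is missing
    must be the last one, and an edge whose predecessor is missing the first; either way the path
    could be prolonged. *)
Lemma maximal_trace : (exists e, bdry K e) ->
  exists e0 s, [/\ path succ e0 s, uniq (e0 :: s), all (bdry K) (e0 :: s),
    forall e, e \in e0 :: s -> bdry K (nxt K e) -> nxt K e \in e0 :: s &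
    forall e, e \in e0 :: s -> bdry K (prv K e) -> prv K e \in e0 :: s].
Proof.
case=> e1 be1.
pose good s := [&& uniq s, all (bdry K) s & sorted succ s].
pose P k := `[< exists2 s, size s = k & good s >].
have exP : exists k, P k.
  by exists 1%N; apply/asboolP; exists [:: e1] => //; rewrite /good /= be1.
have ubP k : P k -> (k <= size bdseq)%N.
  case/asboolP => s <- /and3P[us /allP bs _]; apply: uniq_leq_size => // e es.
  by rewrite mem_bdseq bs.
case: (ex_maxnP exP ubP) => k /asboolP[s sk gs] kmax.
have long s' : (size s < size s')%N -> good s' -> False.
  rewrite sk => lt gs'; have : P (size s') by apply/asboolP; exists s'.
  by move/kmax; rewrite leqNgt lt.
case: s gs sk long => [|e0 s] gs sk long.
  by exfalso; apply: (long [:: e1]) => //; rewrite /good /= be1.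
case/and3P: (gs) => us bs ps; exists e0, s; split=> // e es be.
  apply/negP => /negP nin.
  case/splitPr: es us bs ps nin long {gs sk kmax} => p1 p2 us bs ps nin long.
  case: p2 us bs ps nin long => [|e2 p2] us bs ps nin long.
    apply: (long (rcons (p1 ++ [:: e]) (nxt K e))); first by rewrite size_rcons.
    rewrite /good rcons_uniq nin us all_rcons be bs /=.
    by case: p1 ps {us bs nin long} => [|a p1] /=; rewrite ?eqxx // rcons_path => ->;
      rewrite last_cat /= eqxx.
  have : e2 = nxt K e.
    by move: ps; rewrite sorted_cat_cons => /andP[_ /= /andP[/eqP]].
  by move=> E; rewrite -E mem_cat !inE eqxx !orbT in nin.
apply/negP => /negP nin.
case/splitPr: es us bs ps nin long {gs sk kmax} => p1 p2 us bs ps nin long.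
case/lastP: p1 us bs ps nin long => [|p1 e2] us bs ps nin long.
  apply: (long (prv K e :: (e :: p2))) => //.
  rewrite cat0s in us bs ps nin long *.
  rewrite /good cons_uniq nin us /= be [_ && all _ _]bs /=.
  move: bs => /= /andP[be' _]; rewrite nxt_prv // eqxx /=.
  by move: ps.
have E : e = nxt K e2.
  by move: ps; rewrite cat_rcons sorted_cat_cons => /andP[_ /= /andP[/eqP]].
have be2 : bdry K e2 by move: bs; rewrite cat_rcons all_cat => /and3P[].
by move: nin; rewrite E prv_nxt // cat_rcons mem_cat !inE eqxx !orbT.
Qed.

Section Closed.
Variable T : pred (Z2 * dir).
Hypothesis Tb : forall e, T e -> bdry K e.
Hypothesis Tn : forall e, bdry K e -> bdry K (nxt K e) -> T e = T (nxt K e).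

Definition und z d := T (z, d) || T (mv z d, dopp d).

Lemma und_opp z d : und (mv z d) (dopp d) = und z d.
Proof. by rewrite /und mv_dopp doppK orbC. Qed.

Lemma T_core z d : par z = b -> T (z, d) = false.
Proof.
move=> pz; apply/negP => /Tb; rewrite bdryE => /and3P[zK bz nz].
by have := tK zK bz nz; rewrite pz; case: (b).
Qed.

Lemma face_noncore z d : par z = ~~ b ->
  box n z -> box n (mv (mv z d) (drot d)) ->
  und z d (+) und (mv z d) (drot d) (+) und (mv z (drot d)) d (+) und z (drot d) = false.
Proof.
move=> pz bz bw; have /andP[bp bq] := box_sq' bz bw.
set r := drot d; set p := mv z d; set q := mv z r; set w := mv p r.
have wq : mv w (dopp d) = q by rewrite /w /p (mvC z d r) mv_dopp.
have wp : mv w (dopp r) = p by rewrite /w mv_dopp.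
have pp : par p = b by rewrite par_mv pz negbK.
have pq : par q = b by rewrite par_mv pz negbK.
have qd : mv q d = w by rewrite /q mvC.
rewrite /und qd -/p -/q -/w !(T_core _ pp) !(T_core _ pq) /= !orbF.
have Kp : inz K p -> inz K z && inz K w.
  move=> pK; rewrite (typed_core tK pK pp bw) andbT.
  by have := typed_core tK pK pp (d := dopp d); rewrite mv_dopp; apply.
have Kq : inz K q -> inz K z && inz K w.
  move=> qK; have := typed_core tK qK pq (d := d); rewrite qd => -> //; rewrite andbT.
  by have := typed_core tK qK pq (d := dopp r); rewrite mv_dopp; apply.
have E1 : bdry K (z, d) = inz K z && ~~ inz K p by rewrite bdryE -/p bp.
have E2 : bdry K (z, r) = inz K z && ~~ inz K q by rewrite bdryE -/q bq.
have E3 : bdry K (w, dopp r) = inz K w && ~~ inz K p by rewrite bdryE wp bp.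
have E4 : bdry K (w, dopp d) = inz K w && ~~ inz K q by rewrite bdryE wq bq.
have F e : bdry K e = false -> T e = false.
  by move=> be; apply/negP => /Tb; rewrite be.
have N1 : nxt K (z, d) = if inz K q then (w, dopp r) else (z, r) by [].
have N2 : nxt K (w, dopp d) = if inz K p then (z, r) else (w, dopp r).
  rewrite /nxt /= drot_dopp -/r doppK wp; case: ifP => // _.
  by rewrite wq /q mv_dopp.
have := Tn (e := (z, d)); have := Tn (e := (w, dopp d)).
rewrite {}N1 {}N2.
case: (boolP (inz K p)) Kp Kq E1 E2 E3 E4 => pK Kp Kq E1 E2 E3 E4;
  case: (boolP (inz K q)) Kq E2 E4 => qK Kq E2 E4.
- by rewrite !F // ?E1 ?E2 ?E3 ?E4 ?andbF.
- case/andP: (Kp isT) => zK wK; rewrite ?E2 ?E4 ?E1 ?E3 zK wK /= => -> // _.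
  by rewrite (F (z, d)) ?(F (w, dopp r)) ?E1 ?E3 ?andbF //; case: (T _).
- case/andP: (Kq isT) => zK wK; rewrite ?E2 ?E4 ?E1 ?E3 zK wK /= => _ -> //.
  by rewrite (F (z, r)) ?(F (w, dopp d)) ?E2 ?E4 ?andbF //; case: (T _).
rewrite ?E1 ?E2 ?E3 ?E4 !andbT => h1 h2.
have -> : T (z, d) = T (z, r).
  by case: (boolP (inz K z)) => zK; [exact: h2|]; rewrite !F // ?E1 ?E2 (negbTE zK).
have -> : T (w, dopp d) = T (w, dopp r).
  by case: (boolP (inz K w)) => zK; [exact: h1|]; rewrite !F // ?E3 ?E4 (negbTE zK).
by case: (T _); case: (T _).
Qed.

Lemma face_even z d : box n z -> box n (mv (mv z d) (drot d)) ->
  und z d (+) und (mv z d) (drot d) (+) und (mv z (drot d)) d (+) und z (drot d) = false.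
Proof.
move=> bz bw; have [pz|pz] : par z = ~~ b \/ par z = b by case: (par z) (b) => [] []; auto.
  exact: face_noncore.
have /andP[bp bq] := box_sq' bz bw.
have := @face_noncore (mv z d) (drot d).
rewrite par_mv pz drot_drot mv_dopp und_opp (mvC z d) mv_dopp und_opp.
rewrite (mvC z) in bw *.
move=> /(_ erefl bp bq) <-.
by case: (und _ _); case: (und _ _); case: (und _ _); case: (und _ _).
Qed.

Lemma cocycle_coboundary : exists k : G -> bool, forall u v d,
  gv v = mv (gv u) d -> k u (+) k v = und (gv u) d.
Proof.
pose z (x y : nat) : Z2 := (x%:Z, y%:Z).
have zX x y : mv (z x y) (false, false) = z x.+1 y by rewrite mvE /z /=; congr pair; lia.
have zY x y : mv (z x y) (true, false) = z x y.+1 by rewrite mvE /z /=; congr pair; lia.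
have bz x y : (x < n)%N -> (y < n)%N -> box n (z x y) by rewrite /box /=; lia.
have [|k [kh kv]] := @poincare n (fun x y => und (z x y) (false, false))
  (fun x y => und (z x y) (true, false)).
  move=> x y hx hy /=; have := @face_even (z x y) (false, false).
  rewrite /drot /= !zX !zY; apply; apply: bz; lia.
exists (fun u => k u.1 u.2) => -[a1 a2] [c1 c2] d.
rewrite mvE /grid_vertex /=.
case: d => [[] []] /= [E1 E2].
- have <- : c1 = a1 by apply: ord_inj; lia.
  have E : nat_of_ord a2 = c2.+1 by lia.
  rewrite -[LHS]addbC E kv -?E // -[RHS]und_opp /=.
  by rewrite [mv _ _](_ : _ = z c1 c2) // mvE /z /=; congr pair; lia.
- have <- : c1 = a1 by apply: ord_inj; lia.
  have E : nat_of_ord c2 = a2.+1 by lia.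
  by rewrite E kv // -E.
- have <- : c2 = a2 by apply: ord_inj; lia.
  have E : nat_of_ord a1 = c1.+1 by lia.
  rewrite -[LHS]addbC E kh -?E // -[RHS]und_opp /=.
  by rewrite [mv _ _](_ : _ = z c1 c2) // mvE /z /=; congr pair; lia.
- have <- : c2 = a2 by apply: ord_inj; lia.
  have E : nat_of_ord c1 = a1.+1 by lia.
  by rewrite E kh // -E.
Qed.

(* [T] meets every face evenly, so it is the coboundary of some [k], and [k] is
   constant on [K] and on its complement. *)
Lemma closed_trace_full : conn K -> conn (~: K) -> (exists e, T e) ->
  forall e, bdry K e -> T e.
Proof.
move=> cK cR [e0 Te0].
have [k hk] := cocycle_coboundary.
have kK u v : u \in K -> v \in K -> k u = k v.
  move=> uK vK; apply: connect_const (cK _ _ uK vK) => {uK vK}x y /and3P[/adjP[d E] xK yK].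
  have := hk _ _ _ E; rewrite /und.
  have -> : T (gv x, d) = false.
    by apply/negP => /Tb; rewrite bdryE -E !inz_gv yK !andbF.
  have -> : T (mv (gv x) d, dopp d) = false.
    by apply/negP => /Tb; rewrite bdryE mv_dopp -E !inz_gv xK !andbF.
  by case: (k x) (k y) => [] [].
have kR u v : u \notin K -> v \notin K -> k u = k v.
  move=> uK vK; have uR : u \in ~: K by rewrite inE.
  have vR : v \in ~: K by rewrite inE.
  apply: connect_const (cR _ _ uR vR) => {uK vK uR vR}x y /and3P[/adjP[d E]].
  rewrite !inE => xK yK.
  have := hk _ _ _ E; rewrite /und.
  have -> : T (gv x, d) = false.
    by apply/negP => /Tb; rewrite bdryE inz_gv (negbTE xK).
  have -> : T (mv (gv x) d, dopp d) = false.
    by apply/negP => /Tb; rewrite bdryE -E inz_gv (negbTE yK).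
  by case: (k x) (k y) => [] [].
have cut e : bdry K e -> exists u v, [/\ u \in K, v \notin K, gv u = e.1 & gv v = mv e.1 e.2].
  case: e => z d; rewrite bdryE => /and3P[/inzP[u uK <-] /boxP[v <-]].
  by rewrite inz_gv => vK; exists u, v.
have [u0 [v0 [u0K v0K E1 E2]]] := cut _ (Tb Te0).
case=> z d be; have [u [v [uK vK /= F1 F2]]] := cut _ be.
have := hk u v d; rewrite F1 F2 => /(_ erefl).
(* [k] takes one value on [K] and one on its complement. They differ because of [e0], so every edge
   between the two sides is counted, and only its orientation out of [K] can be in [T]. *)
rewrite (kK _ _ uK u0K) (kR _ _ vK v0K).
have := hk u0 v0 e0.2; rewrite E1 E2 => /(_ erefl) ->.
rewrite /und -surjective_pairing Te0 /= => /esym/orP[//|/Tb].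
by rewrite bdryE -F2 inz_gv (negbTE vK).
Qed.
End Closed.

Lemma trace : conn K -> conn (~: K) -> (exists e, bdry K e) ->
  exists e0 s, [/\ path succ e0 s, uniq (e0 :: s) & forall e, (e \in e0 :: s) = bdry K e].
Proof.
move=> cK cR ex; have [e0 [s [ps us bs cn cp]]] := maximal_trace ex.
exists e0, s; split=> //.
have Tb e : e \in e0 :: s -> bdry K e by move/(allP bs).
have Tn e : bdry K e -> bdry K (nxt K e) -> (e \in e0 :: s) = (nxt K e \in e0 :: s).
  move=> be bn; apply/idP/idP => h; first exact: cn.
  by rewrite -(prv_nxt be); apply: cp; rewrite // prv_nxt.
move=> e; apply/idP/idP; first exact: Tb.
apply: (closed_trace_full Tb Tn) => //.
by exists e0; rewrite inE eqxx.
Qed.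
End Trace.

(** * Taxi walks *)

Definition wv (a : Z2) (s : seq dir) : seq Z2 := scanl mv a s.

Definition taxi_from (a : Z2) (s : seq dir) : bool :=
  [&& path manhattan_arc a (wv a s), uniq (a :: wv a s) & no_repeated_turn s].

Lemma taxi_walkE s : taxi_walk s = taxi_from origin s. Proof. by []. Qed.

Lemma no_repeated_turnE a b c s : no_repeated_turn [:: a, b, c & s] =
  [&& ~~ (left_turn a b && left_turn b c), ~~ (right_turn a b && right_turn b c) &
   no_repeated_turn [:: b, c & s]].
Proof. by []. Qed.

(** * Symmetries of the Manhattan lattice and submultiplicativity *)

Definition flip (p q : bool) (d : dir) : dir := (d.1, d.2 (+) (if d.1 then p else q)).

Lemma flipK p q : involutive (flip p q).
Proof. by case=> [[] []]; case: p; case: q. Qed.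

Lemma left_turn_flip p q d d' : left_turn (flip p q d) (flip p q d') =
  if p == q then left_turn d d' else right_turn d d'.
Proof. by case: d d' p q => [[] []] [[] []] [] []. Qed.

Lemma right_turn_flip p q d d' : right_turn (flip p q d) (flip p q d') =
  if p == q then right_turn d d' else left_turn d d'.
Proof. by case: d d' p q => [[] []] [[] []] [] []. Qed.

Lemma no_repeated_turn_flip p q s :
  no_repeated_turn (map (flip p q) s) = no_repeated_turn s.
Proof.
elim: s => [//|a [|b [|c s]]] // IH.
rewrite ![map _ _]/= !no_repeated_turnE -[in RHS]IH.
by rewrite !left_turn_flip !right_turn_flip; case: (p == q) => //; rewrite andbCA.
Qed.

Section Flip.
Variable a : Z2.
Let p := odd (absz a.1).
Let q := odd (absz a.2).

(* The symmetry of the Manhattan lattice that moves [a] to the origin. *)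
Definition recenter (z : Z2) : Z2 :=
  ((if q then a.1 - z.1 else z.1 - a.1), (if p then a.2 - z.2 else z.2 - a.2)).

Lemma recenter_mv z d : recenter (mv z d) = mv (recenter z) (flip p q d).
Proof.
rewrite !mvE /recenter; case: d => [[] []]; case: (p); case: (q) => /=; congr pair; lia.
Qed.

Lemma recenter_inj : injective recenter.
Proof.
by case=> [x y] [x' y']; rewrite /recenter; case: (p); case: (q) => /= -[] *; congr pair; lia.
Qed.

(** Translating by an odd [a.2] exchanges the two orientations of rows, and reflecting the first
    coordinate restores them; likewise for [a.1], columns and the second coordinate. *)
Lemma recenter_arc u v : manhattan_arc u v -> manhattan_arc (recenter u) (recenter v).
Proof.
have E (k : int) : (-1) ^+ odd (absz k) = (if odd (absz k) then -1 else 1) :> int.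
  by case: odd.
rewrite /manhattan_arc !Z2_eq /= !E /recenter.
case: u v => [x y] [x' y'] /=; rewrite /p /q; case: a => a1 a2 /=.
have oB (k l : int) : odd (absz (k - l)) = odd (absz k) (+) odd (absz l) by lia.
case/orP => /andP[/eqP -> /eqP ->]; apply/orP; [left|right];
  case: (boolP (odd (absz a1))) => h1; case: (boolP (odd (absz a2))) => h2;
  rewrite ?oB ?(negbTE h1) ?(negbTE h2) ?h1 ?h2 /= ?addbF ?addbT; case: (odd _) => /=; lia.
Qed.

Lemma wv_recenter z s : map recenter (wv z s) = wv (recenter z) (map (flip p q) s).
Proof. by elim: s z => //= d s IH z; rewrite IH recenter_mv. Qed.

Lemma taxi_from_flip s : taxi_from a s -> taxi_walk (map (flip p q) s).
Proof.
have Ea : recenter a = origin by rewrite /recenter !subrr; case: (p); case: (q).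
case/and3P => ps us ns; rewrite taxi_walkE /taxi_from no_repeated_turn_flip ns andbT.
rewrite -Ea -wv_recenter -map_cons (map_inj_uniq recenter_inj) us andbT.
by rewrite path_map; apply: sub_path ps => u v; exact: recenter_arc.
Qed.

Lemma card_taxi_from m : (#|[set s : m.-tuple dir | taxi_from a s]| <= taxi_count m)%N.
Proof.
have finj : injective (fun s : m.-tuple dir => [tuple of map (flip p q) s]).
  move=> s t /(congr1 val) /= h; apply/val_inj.
  by apply: (inj_map (can_inj (flipK p q))).
rewrite /taxi_count -(card_imset _ finj); apply/subset_leq_card/subsetP => t.
by case/imsetP => s; rewrite !inE => hs ->; exact: taxi_from_flip.
Qed.
End Flip.

Lemma no_repeated_turn_catl s t : no_repeated_turn (s ++ t) -> no_repeated_turn s.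
Proof.
elim: s => [//|a [|b [|c s]]] // IH; rewrite !cat_cons !no_repeated_turnE.
by case/and3P => -> -> /IH ->.
Qed.

Lemma no_repeated_turn_behead a s : no_repeated_turn (a :: s) -> no_repeated_turn s.
Proof. by case: s => [//|b [//|c s]]; rewrite no_repeated_turnE => /and3P[]. Qed.

Lemma no_repeated_turn_catr s t : no_repeated_turn (s ++ t) -> no_repeated_turn t.
Proof. by elim: s => //= a s IH /no_repeated_turn_behead. Qed.

Lemma wv_cat a s t : wv a (s ++ t) = wv a s ++ wv (last a (wv a s)) t.
Proof. by elim: s a => //= d s IH a; rewrite IH. Qed.

Lemma taxi_from_cat a s t : taxi_from a (s ++ t) -> taxi_from a s && taxi_from (last a (wv a s)) t.
Proof.
case/and3P; rewrite wv_cat cat_path => /andP[p1 p2] us ns.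
rewrite /taxi_from p1 p2 (no_repeated_turn_catl ns) (no_repeated_turn_catr ns) !andbT /=.
rewrite -cat_cons cat_uniq in us; case/and3P: us => u1 h u2.
rewrite cons_uniq in u1; rewrite u1 u2 andbT /=.
by apply: contra h => h; apply/hasP; exists (last a (wv a s)) => //; exact: mem_last.
Qed.

(** The walk is cut after [k] steps. The second piece starts at another vertex, but by symmetry no
    more taxi walks start there than at the origin. *)
Lemma taxi_count_submul k m : (taxi_count (k + m) <= taxi_count k * taxi_count m)%N.
Proof.
pose A := [set x : k.-tuple dir * m.-tuple dir |
  taxi_walk x.1 && taxi_from (last origin (wv origin x.1)) x.2].
have szt (s : (k + m).-tuple dir) : size (take k s) == k.
  by rewrite size_takel // size_tuple leq_addr.
have szd (s : (k + m).-tuple dir) : size (drop k s) == m.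
  by rewrite size_drop size_tuple addKn.
pose f (s : (k + m).-tuple dir) := (Tuple (szt s), Tuple (szd s)).
have finj : injective f.
  move=> s t [] h1 h2; apply: val_inj.
  by rewrite /= -(cat_take_drop k s) -(cat_take_drop k t) h1 h2.
apply: (@leq_trans #|A|).
  rewrite /taxi_count -(card_imset _ finj); apply/subset_leq_card/subsetP => x.
  case/imsetP => s; rewrite !inE => hs ->; rewrite /= taxi_walkE.
  by apply: taxi_from_cat; rewrite cat_take_drop.
rewrite -sum1_card (eq_bigl (fun x : k.-tuple dir * m.-tuple dir =>
  taxi_walk x.1 && taxi_from (last origin (wv origin x.1)) x.2)); last first.
  by move=> x; rewrite inE.
rewrite -(pair_big_dep (fun s : k.-tuple dir => taxi_walk s)
  (fun s (t : m.-tuple dir) => taxi_from (last origin (wv origin s)) t) (fun _ _ => 1%N)) /=.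
rewrite {1}/taxi_count -sum1_card big_distrl /=.
rewrite [X in (_ <= X)%N](eq_bigl (fun s : k.-tuple dir => taxi_walk s)); last first.
  by move=> x; rewrite inE.
apply: leq_sum => s _; rewrite mul1n; apply: leq_trans (card_taxi_from (last origin (wv origin s)) m).
by rewrite -sum1_card; apply: eq_leq; apply: eq_bigl => t; rewrite inE.
Qed.

(** Doubled steps to the right or upwards. From the origin such walks turn only at points with even
    coordinates, where both positive directions are allowed; they supply the lower bound on the
    number of taxi walks. *)
Fixpoint dbl (t : seq bool) : seq dir :=
  if t is b :: t' then [:: (b, false), (b, false) & dbl t'] else [::].

Lemma dbl_cons b t : dbl (b :: t) = [:: (b, false), (b, false) & dbl t].
Proof. by []. Qed.

Lemma size_dbl t : size (dbl t) = (2 * size t)%N.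
Proof. by elim: t => //= b t ->; rewrite mulnS. Qed.

Lemma dbl_nrt x t : no_repeated_turn (x :: dbl t).
Proof.
have nl (y : dir) : left_turn y y = false by case: y => [[] []].
have nr (y : dir) : right_turn y y = false by case: y => [[] []].
elim: t x => [//|b t IH] x; rewrite dbl_cons no_repeated_turnE nl nr !andbF !andTb.
case: t IH => [//|b' t] IH; have := IH (b, false).
by move=> h; rewrite dbl_cons no_repeated_turnE nl nr; exact: h.
Qed.

Lemma dbl_arcs a t : ~~ odd (absz a.1) -> ~~ odd (absz a.2) ->
  path manhattan_arc a (wv a (dbl t)).
Proof.
elim: t a => [//|b t IH] a h1 h2; rewrite dbl_cons [wv _ _]/= -/(wv _ _) [path _ _ _]/=.
have E (k : int) : (-1) ^+ odd (absz k) = (if odd (absz k) then -1 else 1) :> int.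
  by case: odd.
rewrite !mvE; case: b => /=.
  rewrite /manhattan_arc !Z2_eq /= !E (negbTE h1) !eqxx !orbT /=.
  by apply: IH => //=; lia.
rewrite /manhattan_arc !Z2_eq /= !E (negbTE h2) !eqxx /=.
by apply: IH => //=; lia.
Qed.

Lemma dbl_mono a t :
  path (fun u v : Z2 => u.1 + u.2 < v.1 + v.2) a (wv a (dbl t)).
Proof.
elim: t a => [//|b t IH] a; rewrite dbl_cons [wv _ _]/= -/(wv _ _) [path _ _ _]/= IH andbT.
by case: b; rewrite /step /=; lia.
Qed.

Lemma dbl_taxi t : taxi_walk (dbl t).
Proof.
rewrite taxi_walkE /taxi_from dbl_arcs // (no_repeated_turn_behead (dbl_nrt (true, true) t)).
rewrite andbT; apply: (@sorted_uniq _ (fun u v : Z2 => u.1 + u.2 < v.1 + v.2)).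
- by move=> u v w /=; exact: lt_trans.
- by move=> u; rewrite /= ltxx.
- exact: dbl_mono.
Qed.

Lemma taxi_count_ge k : (2 ^ k <= taxi_count (2 * k))%N.
Proof.
have sz (t : k.-tuple bool) : size (dbl t) == (2 * k)%N.
  by rewrite size_dbl size_tuple.
have finj : injective (fun t : k.-tuple bool => Tuple (sz t)).
  move=> t t' /(congr1 val) /= h; apply: val_inj => /=.
  elim: (tval t) (tval t') h => [|b s IH] [|b' s'] //=.
  by move=> h; case: h => hb _ /IH ->; rewrite hb.
have -> : (2 ^ k = #|{: k.-tuple bool}|)%N by rewrite card_tuple card_bool.
rewrite -cardsT -(card_imset _ finj); apply/subset_leq_card/subsetP => t.
by case/imsetP => s _ ->; rewrite inE dbl_taxi.
Qed.

Lemma taxi_count_gt0 m : (0 < taxi_count m)%N.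
Proof.
have h : (0 < taxi_count (m + m))%N.
  by rewrite addnn -mul2n (leq_trans _ (taxi_count_ge m)) ?expn_gt0.
by have := leq_trans h (taxi_count_submul m m); rewrite muln_gt0 => /andP[].
Qed.

(** * Contours are taxi walks *)

(** Taxi steps made by a contour at an edge crossed in direction [d]: [lstep] when the contour turns
    left around the inner cell, [rstep] when it turns right. [tdir] is the direction in which the
    next edge is crossed. *)
Definition lstep (d : dir) : dir := (~~ d.1, ~~ d.2).
Definition rstep (d : dir) : dir := (d.1, d.2 (+) d.1).
Definition tstep (l : bool) (d : dir) : dir := if l then lstep d else rstep d.
Definition tdir (l : bool) (d : dir) : dir := if l then drot d else dopp (drot d).

(** Each taxi step records one turn of the contour. Two like taxi turns in a row involve three
    steps, and checking all directions shows the three contour turns to be alike. *)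
Lemma repeated_turn (l0 l1 l2 : bool) (d : dir) :
  let d1 := tdir l0 d in let d2 := tdir l1 d1 in
  (left_turn (tstep l0 d) (tstep l1 d1) && left_turn (tstep l1 d1) (tstep l2 d2)) ||
  (right_turn (tstep l0 d) (tstep l1 d1) && right_turn (tstep l1 d1) (tstep l2 d2)) ->
  (l0 == l1) && (l1 == l2).
Proof. by case: d l0 l1 l2 => [[] []] [] [] []. Qed.

(* Midpoints of grid edges, rotated by 45 degrees and rescaled, are the vertices
   of the Manhattan lattice; [b] fixes the translation that matches the arcs. *)
Definition pos (b : bool) (e : Z2 * dir) : Z2 :=
  (e.1.1 + e.1.2 + b%:Z - e.2.2%:Z, e.1.1 - e.1.2 + (~~ b)%:Z - (e.2.1 (+) e.2.2)%:Z).

Lemma connect_ind (T : finType) (e : rel T) (P : T -> Prop) :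
  (forall x y, e x y -> P x -> P y) -> forall x y, connect e x y -> P x -> P y.
Proof.
move=> h x y /connectP[p pp ->]; elim: p x pp => //= a p IH x /andP[/h ha /IH hp] px.
exact/hp/ha.
Qed.

Section Code.
Variable n : nat.
Local Notation G := (grid n).
Local Notation gv := (@grid_vertex n).
Implicit Types (K : {set G}) (z : Z2) (d : dir) (e : Z2 * dir).

Definition lft K e := ~~ inz K (mv e.1 (drot e.2)).

Lemma nxt_dir K e : (nxt K e).2 = tdir (lft K e) e.2.
Proof. by rewrite /nxt /tdir /lft; case: ifP. Qed.

Lemma pos_nxt b K e : pos b (nxt K e) = mv (pos b e) (tstep (lft K e) e.2).
Proof.
case: e => [[x y] d]; rewrite /nxt /lft; case: ifP => _ /=;
by rewrite !mvE /pos; case: d => [[] []] /=; congr pair; lia.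
Qed.

Lemma pos_arc b l u d : par u = ~~ b -> manhattan_arc (pos b (u, d)) (mv (pos b (u, d)) (tstep l d)).
Proof.
have E (k : int) : (-1) ^+ odd (absz k) = (if odd (absz k) then -1 else 1) :> int.
  by case: odd.
case: u => [x y]; rewrite /par /= => hp.
rewrite /manhattan_arc !Z2_eq mvE !E /pos /=.
case: b hp; case: d l => [[] []] [] /= hp; case: ifP => h1; case: ifP => h2;
  apply/orP; first [exfalso; lia | by left; lia | by right; lia].
Qed.

Lemma pos_inj b u d u' d' : par u = ~~ b -> par u' = ~~ b ->
  pos b (u, d) = pos b (u', d') -> (u, d) = (u', d').
Proof.
case: u u' => [x y] [x' y']; rewrite /par /pos /=.
by case: d d' => [[] []] [[] []] /= h h' [] h1 h2; first [exfalso; lia | congr (_, _); congr pair; lia].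
Qed.

Definition nontrivial K := forall z, inz K z -> exists d, inz K (mv z d).

Lemma conn_nontrivial K : conn K -> (1 < #|K|)%N -> nontrivial K.
Proof.
move=> cK /card_gt1P[x [y [xK yK xy]]] _ /inzP[u uK <-].
have [v [vK uv]] : exists v, v \in K /\ u != v.
  by case: (eqVneq u x) => [->|ux]; [exists y | exists x].
have /connectP[[|w p]] := cK _ _ uK vK; first by move=> _ E; rewrite E eqxx in uv.
move=> /andP[/and3P[/adjP[d E] _ wK] _] _.
by exists d; rewrite -E inz_gv.
Qed.

Section OneK.
Variables (b : bool) (K : {set G}).
Hypothesis tK : typed b K.
Hypothesis nK : nontrivial K.
Hypothesis nR : nontrivial (~: K).

Lemma all_dirs (P : dir -> Prop) d : P d -> P (drot d) -> P (dopp d) -> P (drot (dopp d)) ->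
  forall d', P d'.
Proof. by case: d => [[] []] ? ? ? ? [[] []]. Qed.

(* Three equal turns in a row would go round a single cell, isolated on its side. *)
Lemma no_triple_turn e : bdry K e -> bdry K (nxt K e) -> bdry K (nxt K (nxt K e)) ->
  bdry K (nxt K (nxt K (nxt K e))) ->
  ~~ ((lft K e == lft K (nxt K e)) && (lft K (nxt K e) == lft K (nxt K (nxt K e)))).
Proof.
case: e => u d b0 b1 b2 b3; apply/negP => /andP[/eqP].
rewrite /lft; case: (boolP (inz K (mv u (drot d)))) => h0 /= h1.
  rewrite -h1 => /eqP h2.
  set v := mv u d.
  have vR : inz (~: K) v by case/andP: b0.
  have N1 : nxt K (u, d) = (mv v (drot d), dopp (drot d)) by rewrite /nxt /= h0.
  move: b1 b2 b3 h1 h2; rewrite N1 /=.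
  rewrite drot_dopp drot_drot doppK => b1 b2 b3 /esym/negbFE h1.
  have N2 : nxt K (mv v (drot d), dopp (drot d)) = (mv v d, dopp d).
    rewrite /nxt /= drot_dopp drot_drot doppK h1; congr pair.
    by rewrite mv_dopp.
  move: b2 b3; rewrite N2 /= drot_dopp => b2 b3 /esym/negbFE h2.
  have [d'] := nR vR; rewrite inzC => /andP[_ /negP]; apply.
  apply: (all_dirs (P := fun d' => inz K (mv v d')) (d := d)).
  - by case/andP: b2.
  - by case/andP: b1.
  - by rewrite /v mv_dopp; case/andP: b0.
  - by move: b3; rewrite /nxt /= drot_dopp h2 => /andP[/= + _]; rewrite mv_dopp.
rewrite -h1 => /eqP h2.
have uK : inz K u by case/andP: b0.
have N1 : nxt K (u, d) = (u, drot d) by rewrite /nxt /= (negbTE h0).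
move: b1 b2 b3 h1 h2; rewrite N1 /= => b1 b2 b3 /esym h1.
have N2 : nxt K (u, drot d) = (u, dopp d) by rewrite /nxt /= (negbTE h1) drot_drot.
move: b2 b3; rewrite N2 /= => b2 b3 /esym h2.
have N3 : nxt K (u, dopp d) = (u, drot (dopp d)) by rewrite /nxt /= (negbTE h2).
move: b3; rewrite N3 => b3.
have [d'] := nK uK; apply/negP.
have out d0 : bdry K (u, d0) -> ~~ inz K (mv u d0).
  by rewrite bdryE => /and3P[].
by apply: (all_dirs (P := fun d' => ~~ inz K (mv u d')) (d := d)); exact: out.
Qed.

Local Notation succ := (fun e e' => e' == nxt K e).
Definition stepof e := tstep (lft K e) e.2.

Lemma walk_of_trace e0 s : path succ e0 s ->
  wv (pos b e0) (map stepof (belast e0 s)) = map (pos b) s.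
Proof. by elim: s e0 => //= e s IH e0 /andP[/eqP -> /IH <-]; rewrite pos_nxt. Qed.

Lemma no_repeated_turn_trace e0 s : path succ e0 s -> all (bdry K) (e0 :: s) ->
  no_repeated_turn (map stepof (belast e0 s)).
Proof.
elim: s e0 => [//|e1 s IH] e0; case: s IH => [//|e2 [|e3 s]] IH //.
move=> /= /andP[/eqP E1 p1] /andP[b0 b1]; have := IH e1 p1 b1.
move: p1 b1 => /= /and3P[/eqP E2 /eqP E3 p3] /and4P[b1 b2 b3 _] ->.
rewrite andbT -negb_or; apply/negP => h.
have := @no_triple_turn e0 b0; rewrite -E1 -E2 -E3 => /(_ b1 b2 b3)/negP; apply.
move: h; rewrite /stepof E2 E1 !nxt_dir; exact: repeated_turn.
Qed.

Lemma arcs_of_trace e0 s : path succ e0 s -> all (bdry K) (e0 :: s) ->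
  path manhattan_arc (pos b e0) (map (pos b) s).
Proof.
elim: s e0 => //= e1 s IH e0 /andP[/eqP E1 p1] /andP[b0 b1].
rewrite IH // andbT E1 pos_nxt; case: e0 b0 {E1} => u d.
by rewrite bdryE => /and3P[uK bv vK]; apply: pos_arc; exact: tK vK.
Qed.

End OneK.

Definition bd K : {set G * dir} := [set e : G * dir | bdry K (gv e.1, e.2)].

(** The size conditions, with connectedness, exclude isolated cells of [K] and of its complement,
    around which a contour could make three like turns in a row. *)
Record contour_set (b : bool) K : Prop := ContourSet {
  cs_typed : typed b K;
  cs_conn : conn K;
  cs_connC : conn (~: K);
  cs_card : (1 < #|K|)%N;
  cs_cardC : (1 < #|~: K|)%N }.

Lemma par_bdry b K e : typed b K -> bdry K e -> par e.1 = ~~ b.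
Proof. by case: e => u d tK; rewrite bdryE => /and3P[uK bv vK]; exact: tK vK. Qed.

Lemma bdry_bd K e : bdry K e -> exists2 f : G * dir, f \in bd K & e = (gv f.1, f.2).
Proof.
case: e => z d be; have /inzP[u _ E] : inz K z by case/andP: be.
by exists (u, d); rewrite ?inE /= E.
Qed.

(** Otherwise membership in [K] would be constant along the edges of the connected grid. *)
Lemma exists_bdry K : conn [set: G] -> (0 < #|K|)%N -> (0 < #|~: K|)%N ->
  exists e, bdry K e.
Proof.
move=> cG /card_gt0P[x xK] /card_gt0P[y yK].
case: (pselect (exists e, bdry K e)) => // no; exfalso.
have /connect_const : forall u v, gin [set: G] u v -> (u \in K) = (v \in K).
  have half u v : grid_adj u v -> u \in K -> v \in K.
    move=> /adjP[d E] uK; apply: contraT => vK; case: no; exists (gv u, d).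
    by rewrite bdryE -E box_gv !inz_gv uK.
  move=> u v /and3P[uv _ _]; apply/idP/idP; apply: half => //.
  move: uv; rewrite /grid_adj /Z2_adj; lia.
move=> /(_ x y (cG _ _ (in_setT _) (in_setT _))).
by rewrite xK; move: yK; rewrite inE => /negbTE ->.
Qed.

Section Trace.
Variables (K : {set G}) (e0 : Z2 * dir) (s : seq (Z2 * dir)).
Hypothesis uniq_s : uniq (e0 :: s).
Hypothesis mem_s : forall e, (e \in e0 :: s) = bdry K e.

Lemma perm_trace : perm_eq (e0 :: s) [seq (gv f.1, f.2) | f <- enum (bd K)].
Proof.
apply: uniq_perm => //.
  rewrite map_inj_uniq ?enum_uniq // => -[[u1 u2] d] [[v1 v2] d'] [].
  by move=> /ord_inj -> /ord_inj -> ->.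
move=> e; rewrite mem_s; apply/idP/mapP.
  by case/bdry_bd => f fb ->; exists f; rewrite ?mem_enum.
by case=> f; rewrite mem_enum inE => h ->.
Qed.

Lemma count_trace (p : pred dir) :
  count (fun e => p e.2) (e0 :: s) = #|[set f in bd K | p f.2]|.
Proof.
rewrite (seq.permP perm_trace) count_map -size_filter cardE.
apply: perm_size; apply: uniq_perm; [exact/filter_uniq/enum_uniq | exact: enum_uniq |].
by move=> f; rewrite mem_filter !mem_enum !inE andbC.
Qed.

Lemma size_trace : size (e0 :: s) = #|bd K|.
Proof. by rewrite (perm_size perm_trace) size_map -cardE. Qed.

End Trace.

Lemma alternate_count (T : eqType) (r : rel T) (p : pred T) x s :
  (forall a c, r a c -> p c = ~~ p a) -> path r x s ->
  (size (x :: s) <= 2 * count p (x :: s) + ~~ p x)%N.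
Proof.
move=> h; elim: s x => [|y s IH] x /=; first by case: (p x).
case/andP => /h pxy /IH /=; rewrite pxy; case: (p x) => /=; lia.
Qed.

(** * Encoding and counting contours *)

Section Contour.
Variables (b : bool) (K : {set G}).
Hypothesis cG : conn [set: G].
Hypothesis csK : contour_set b K.

Lemma contour_trace : exists e0 s, [/\ path (fun e e' => e' == nxt K e) e0 s, uniq (e0 :: s) &
   forall e, (e \in e0 :: s) = bdry K e].
Proof.
case: csK => tK cK cR c1 c2; apply: (trace tK cK cR).
by apply: exists_bdry => //; exact: ltnW.
Qed.

(** The contour makes a right-angled turn at every edge, so horizontal and vertical crossings
    alternate along it. *)
Lemma bd_le_horizontal :
  (#|bd K| <= 2 * #|[set f in bd K | ~~ f.2.1]| + 1)%N.
Proof.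
have [e0 [s [ps us ms]]] := contour_trace.
rewrite -(size_trace us ms) -(count_trace us ms (fun d => ~~ d.1)).
apply: leq_trans (alternate_count (p := fun e => ~~ e.2.1) _ ps) _; last first.
  by rewrite leq_add2l; case: (~~ _).
by move=> e e' /eqP ->; rewrite nxt_dir /tdir; case: ifP => _ /=; case: (e.2.1).
Qed.

(** The whole boundary is one path, and only its last edge can have its successor off the
    boundary. *)
Lemma unique_exit e e' : bdry K e -> bdry K e' ->
  ~~ bdry K (nxt K e) -> ~~ bdry K (nxt K e') -> e = e'.
Proof.
have [e0 [s [ps us ms]]] := contour_trace.
suff L f : bdry K f -> ~~ bdry K (nxt K f) -> f = last e0 s.
  by move=> be be' ne ne'; rewrite (L _ be ne) (L _ be' ne').
move=> bf nf; have : f \in e0 :: s by rewrite ms.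
case/splitPr E : _ / => [p1 p2]; case: p2 E => [|f' p2] E.
  by rewrite -(last_cons e0 e0 s) E last_cat.
have : sorted (fun e e' => e' == nxt K e) (e0 :: s) by [].
rewrite E sorted_cat_cons => /andP[_ /= /andP[/eqP E' _]].
by move: nf; rewrite -E' -ms E mem_cat !inE eqxx !orbT.
Qed.

(** A code is a starting edge with a taxi walk from its position. The boundary of [K] is read off as
    the edges with inner parity [~~ b] whose position is visited; on such edges [pos] is
    injective. *)
Definition codes l (x : (G * dir) * l.-tuple dir) : bool :=
  let p := pos b (gv x.1.1, x.1.2) in
  taxi_from p x.2 && [forall f : G * dir,
    (f \in bd K) == (par (gv f.1) == ~~ b) && (pos b (gv f.1, f.2) \in p :: wv p x.2)].

Lemma exists_code l : #|bd K| = l.+1 -> exists x, codes (l := l) x.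
Proof.
move=> hl; have [e0 [s [ps us ms]]] := contour_trace.
case: (csK) => tK cK cR c1 c2.
have al : all (bdry K) (e0 :: s) by apply/allP => e; rewrite ms.
have [f0 f0b E0] : exists2 f : G * dir, f \in bd K & e0 = (gv f.1, f.2).
  by apply: bdry_bd; rewrite -ms inE eqxx.
have sz : size (map (stepof K) (belast e0 s)) == l.
  by rewrite size_map size_belast -eqSS -hl -(size_trace us ms).
exists (f0, Tuple sz); rewrite /codes /= -E0 (walk_of_trace b ps).
have inj : {in bdry K &, injective (pos b)}.
  move=> [u d] [u' d'] h h' /pos_inj; apply; first exact: par_bdry tK h.
  exact: par_bdry tK h'.
have injs : {in e0 :: s &, injective (pos b)}.
  by move=> x y; rewrite !ms; exact: inj.
apply/andP; split.
  rewrite /taxi_from (walk_of_trace b ps) (arcs_of_trace tK ps al) -map_cons.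
  rewrite (map_inj_in_uniq injs) us /=.
  by apply: no_repeated_turn_trace => //; exact: conn_nontrivial.
apply/forallP => f; have -> : (f \in bd K) = bdry K (gv f.1, f.2) by rewrite inE.
apply/eqP; apply/idP/idP => [bf|/andP[/eqP pf]].
  rewrite (par_bdry tK bf) eqxx /= -map_cons; apply: map_f; by rewrite ms.
rewrite -map_cons => /mapP[[u d] ue] /pos_inj.
rewrite ms in ue; rewrite pf (par_bdry tK ue) => /(_ erefl erefl) ->.
exact: ue.
Qed.

End Contour.

(** The two sets share an inner end of a boundary edge. A path inside [K] cannot leave [K'], since
    it would cross an edge of [bd K' = bd K] with both ends in [K]. *)
Lemma bd_inj b b' K K' : conn [set: G] -> contour_set b K -> contour_set b' K' ->
  bd K = bd K' -> K = K'.
Proof.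
move=> cG; wlog suff : K K' b b' / contour_set b K -> contour_set b' K' -> bd K = bd K' -> K \subset K'.
  by move=> W h h' E; apply/eqP; rewrite eqEsubset (W K K' b b') // (W K' K b' b).
move=> [_ cK _ c1 c2] [_ _ _ _ _] E.
have [e /bdry_bd[f fb _]] := exists_bdry cG (ltnW c1) (ltnW c2).
have f1 : f.1 \in K by move: fb; rewrite inE => /andP[/=]; rewrite inz_gv.
have f1' : f.1 \in K' by move: fb; rewrite E inE => /andP[/=]; rewrite inz_gv.
apply/subsetP => w wK; move: f1'.
apply: (connect_ind (P := fun x => x \in K')) (cK _ _ f1 wK) => x y /and3P[/adjP[d xy] xK yK] xK'.
apply: contraT => yK'.
have : (x, d) \in bd K' by rewrite inE bdryE -xy box_gv !inz_gv xK' yK'.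
by rewrite -E inE bdryE -xy !inz_gv yK !andbF.
Qed.

(** A code has at most [4 * n ^ 2] starting edges, and it determines the boundary, hence the set. *)
Lemma card_contour_sets b l : conn [set: G] ->
  (#|[set K | `[< contour_set b K >] && (#|bd K| == l.+1)]| <= 4 * n ^ 2 * taxi_count l)%N.
Proof.
move=> cG; set X := [set K | _].
pose Y := [set x : (G * dir) * l.-tuple dir | taxi_from (pos b (gv x.1.1, x.1.2)) x.2].
apply: (@leq_trans #|Y|); last first.
  rewrite -sum1_card (eq_bigl (fun x : (G * dir) * l.-tuple dir =>
    true && taxi_from (pos b (gv x.1.1, x.1.2)) x.2)); last first.
    by move=> x; rewrite inE.
  rewrite -(pair_big_dep (fun x : G * dir => true)
    (fun x (t : l.-tuple dir) => taxi_from (pos b (gv x.1, x.2)) t) (fun _ _ => 1%N)) /=.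
  have -> : (4 * n ^ 2 = #|{: G * dir}|)%N.
    by rewrite !card_prod card_bool card_ord; lia.
  rewrite -sum_nat_const; apply: leq_sum => x _.
  apply: leq_trans (card_taxi_from (pos b (gv x.1, x.2)) l).
  by rewrite -sum1_card; apply: eq_leq; apply: eq_bigl => t; rewrite inE.
pose decode (x : (G * dir) * l.-tuple dir) := odflt set0 [pick K in X | codes b K x].
apply: leq_trans (leq_imset_card decode (mem Y)); apply/subset_leq_card/subsetP => K KX.
move: (KX); rewrite inE => /andP[/asboolP csK /eqP hl].
have [x xK] := exists_code cG csK hl.
apply/imsetP; exists x; first by rewrite inE; case/andP: xK.
rewrite /decode; case: pickP => [K' /andP[K'X xK']|/(_ K)]; last by rewrite KX xK.
move: K'X; rewrite inE => /andP[/asboolP csK' _].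
apply: (bd_inj cG csK csK'); apply/setP => f.
case/andP: xK => _ /forallP/(_ f)/eqP ->.
by case/andP: xK' => _ /forallP/(_ f)/eqP ->.
Qed.
End Code.

(** * Shifting the inside of a contour *)

Section Shift.
Variable n : nat.
Local Notation G := (grid n).
Local Notation gv := (@grid_vertex n).
Implicit Types (K J S : {set G}) (z : Z2) (d : dir) (u v w : G).

Definition east : dir := (false, false).
Definition west : dir := (false, true).

Lemma mv_we z : mv (mv z west) east = z. Proof. exact: (dopp_mv z east). Qed.
Lemma mv_ew z : mv (mv z east) west = z. Proof. exact: (mv_dopp z east). Qed.

Definition gmv u d : G := odflt u [pick v | gv v == mv (gv u) d].

Lemma gmvE u d : box n (mv (gv u) d) -> gv (gmv u d) = mv (gv u) d.
Proof.
move=> /boxP[v hv]; rewrite /gmv; case: pickP => [w /eqP //|/(_ v)].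
by rewrite hv eqxx.
Qed.

Definition compat J K := forall z d, inz K z -> box n (mv z d) -> ~~ inz K (mv z d) ->
  ~~ inz J z && ~~ inz J (mv z d).

Definition misses_right K := forall u, u \in K -> (u.1.+1 < n)%N.

Definition exits K : {set G} :=
  [set u in K | box n (mv (gv u) east) && ~~ inz K (mv (gv u) east)].
Definition entries K : {set G} :=
  [set u in K | box n (mv (gv u) west) && ~~ inz K (mv (gv u) west)].
Definition leftcol K : {set 'I_n} := [set y : 'I_n | inz K (0, y%:Z)].

(** The part inside [K] moves one step west, which drops its cells in the left column and frees
    [exits K] for an arbitrary [S]. *)
Definition shift K J S : {set G} :=
  [set w | [|| inz (J :&: K) (mv (gv w) east), (w \in J) && (w \notin K) | w \in S]].

Lemma inzI J K z : inz (J :&: K) z = inz J z && inz K z.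
Proof.
apply/idP/andP => [/inzP[u] | [/inzP[u uJ <-]]]; last by rewrite !inz_gv !inE uJ.
by rewrite inE => /andP[uJ uK] <-; rewrite !inz_gv.
Qed.

Lemma independentP J :
  reflect (forall z d, inz J z -> inz J (mv z d) -> False) (independent (@grid_adj n) J).
Proof.
apply: (iffP forall_inP) => [h z d /inzP[u uJ <-] /inzP[v vJ E]|h u uJ].
  have /forall_inP/(_ v vJ)/negP := h u uJ; apply; apply/adjP; by exists d.
apply/forall_inP => v vJ; apply/negP => /adjP[d E].
by apply: (h (gv u) d); rewrite -?E inz_gv.
Qed.

Section OneContour.
Variables (b : bool) (K : {set G}).
Hypothesis tK : typed b K.

Section OneConfig.
Variables (J S : {set G}).
Hypothesis cJ : compat J K.
Hypothesis SF : S \subset exits K.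
Hypothesis iJ : independent (@grid_adj n) J.

Lemma exitP w : w \in S -> [/\ w \in K, box n (mv (gv w) east) & ~~ inz K (mv (gv w) east)].
Proof. by move/(subsetP SF); rewrite inE => /andP[-> /andP[-> ->]]. Qed.

Lemma moved_in w : inz (J :&: K) (mv (gv w) east) -> w \in K.
Proof.
rewrite inzI => /andP[wJ wK]; apply: contraT => nw.
have := @cJ _ west wK; rewrite mv_ew box_gv !inz_gv => /(_ isT nw)/andP[].
by rewrite wJ.
Qed.

Lemma kept_moved_adj v w d : v \in J -> v \notin K -> w \in K -> gv v = mv (gv w) d -> False.
Proof.
move=> vJ vK wK E; have := cJ (z := gv w) (d := d).
by rewrite -E !inz_gv box_gv => /(_ wK isT vK)/andP[_]; rewrite vJ.
Qed.

Lemma mv_shift_adj v w d d' : gv v = mv (gv w) d -> mv (gv v) d' = mv (mv (gv w) d') d.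
Proof. by move=> ->; exact: mvC. Qed.

Lemma adj_sym v w d : gv v = mv (gv w) d -> gv w = mv (gv v) (dopp d).
Proof. by move=> ->; rewrite mv_dopp. Qed.

Lemma moved_added_adj v w d : inz (J :&: K) (mv (gv v) east) -> w \in S ->
  gv v = mv (gv w) d -> False.
Proof.
rewrite inzI => /andP[vJ vK] /exitP[wK bw nw] E.
have := cJ vK (d := dopp d); rewrite (mv_shift_adj east E) mv_dopp bw nw -(mv_shift_adj east E) vJ.
by move=> /(_ isT isT).
Qed.

Lemma added_par w : w \in S -> par (gv w) = ~~ b.
Proof. by case/exitP => wK bw nw; apply: (tK (d := east)); rewrite ?inz_gv. Qed.

(** Two moved cells keep their relative position, and so do two kept ones. Moved and added cells lie
    in [K], so by compatibility no kept cell is next to them. A moved cell next to an added [w]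
    would come from an occupied cell of [K] next to the cell east of [w], which is outside [K]. Two
    added cells have the same parity. *)
Lemma shift_independent : independent (@grid_adj n) (shift K J S).
Proof.
apply/forall_inP => v hv; apply/forall_inP => w hw; apply/negP => /adjP[d E].
have E' := adj_sym E; move: hv hw; rewrite !inE.
case/or3P => [v1|/andP[v2 v2']|v3]; case/or3P => [w1|/andP[w2 w2']|w3].
- have /independentP/(_ (mv (gv v) east) d) := iJ.
  move: v1 w1; rewrite !inzI (mv_shift_adj east E) => /andP[-> _] /andP[-> _]; exact.
- exact: (kept_moved_adj w2 w2' (moved_in v1) E).
- exact: (moved_added_adj v1 w3 E').
- exact: (kept_moved_adj v2 v2' (moved_in w1) E').
- have /independentP/(_ (gv v) d) := iJ; rewrite -E !inz_gv; exact.
- by case: (exitP w3) => wK _ _; exact: (kept_moved_adj v2 v2' wK E').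
- exact: (moved_added_adj w1 v3 E).
- by case: (exitP v3) => vK _ _; exact: (kept_moved_adj w2 w2' vK E).
- by have := added_par w3; rewrite E par_mv (added_par v3); case: (b).
Qed.

Lemma shift_outside w : w \notin K -> (w \in shift K J S) = (w \in J).
Proof.
move=> wK; rewrite inE wK andbT.
case: (boolP (inz _ _)) => [/moved_in|_]; first by rewrite (negbTE wK).
by case: (boolP (w \in S)) => [/exitP[]|_]; rewrite ?(negbTE wK) ?orbF.
Qed.

Lemma shift_exits : shift K J S :&: exits K = S.
Proof.
apply/setP => w; rewrite !inE; case: (boolP (w \in S)) => [wS|_].
  by case: (exitP wS) => -> -> ->; rewrite !orbT.
rewrite orbF; apply/negP => /andP[h /and3P[wK bw nw]].
by move: h; rewrite inzI (negbTE nw) wK !andbF.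
Qed.

Lemma shift_inside z : inz K z -> box n (mv z west) -> inz J z = inz (shift K J S) (mv z west).
Proof.
move=> zK /boxP[w E]; rewrite -E inz_gv inE E mv_we inzI zK andbT.
case: (boolP (inz J z)) => //= nJ; apply/esym/negP => /orP[/andP[wJ wK]|/exitP[wK bw]].
  by case/inzP: zK E => u uK <- E; exact: (kept_moved_adj wJ wK uK E).
by rewrite E mv_we zK.
Qed.

Lemma card_shift : (#|shift K J S| + #|leftcol (J :&: K)| = #|J| + #|S|)%N.
Proof.
pose A := [set w | inz (J :&: K) (mv (gv w) east)].
have e1 : #|shift K J S| = (#|A| + #|J :\: K| + #|S|)%N.
  have -> : shift K J S = (A :|: (J :\: K)) :|: S.
    by apply/setP => w; rewrite !inE orbA [(w \notin K) && _]andbC.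
  rewrite !cardsU; have -> : A :&: (J :\: K) = set0.
    apply/setP => w; rewrite !inE; apply/negP => /andP[/moved_in wK /andP[]].
    by rewrite wK.
  have -> : (A :|: (J :\: K)) :&: S = set0.
    apply/setP => w; rewrite !inE; apply/negP => /andP[h /exitP[wK _ nw]].
    by move: h; rewrite inzI (negbTE nw) wK !andbF.
  by rewrite cards0 !subn0.
pose B := [set u in J :&: K | box n (mv (gv u) west)].
have cAB : #|A| = #|B|.
  have inj : {in B &, injective (gmv^~ west)}.
    move=> u v; rewrite !inE => /andP[_ bu] /andP[_ bv] /(congr1 gv).
    by rewrite !gmvE // => /mv_inj/gv_inj.
  rewrite -(card_in_imset inj); congr #|pred_of_set _|; apply/setP => w.
  apply/idP/imsetP => [|[u uB ->]].
    rewrite inE => /inzP[u uJK E]; exists u.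
      by rewrite inE uJK E mv_ew box_gv.
    by apply: gv_inj; rewrite gmvE E mv_ew ?box_gv.
  move: uB; rewrite !inE => /andP[uJK bu]; rewrite gmvE // mv_we.
  by rewrite inz_gv inE.
pose D := [set u in J :&: K | ~~ box n (mv (gv u) west)].
have cD : #|leftcol (J :&: K)| = #|D|.
  have inj : {in D &, injective (fun u : G => u.2)}.
    have x0 u : u \in D -> u.1 = 0%N :> nat.
      by rewrite inE => /andP[_]; case: u => [[x hx] [y hy]]; rewrite mvE /box /=; lia.
    move=> u v uD vD /= h; move: (x0 u uD) (x0 v vD).
    by case: u v h {uD vD} => [u1 u2] [v1 v2] /= -> h1 h2; congr pair; apply: ord_inj; rewrite h1.
  rewrite -(card_in_imset inj); congr #|pred_of_set _|; apply/setP => y.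
  apply/idP/imsetP => [|[u]].
    rewrite inE => /inzP[u uJK E]; exists u; last first.
      by apply: ord_inj; case: E => _ ->.
    by rewrite inE uJK E mvE /box /=; lia.
  rewrite !inE => /andP[uJK bu] ->.
  suff -> : (0, (u.2 : nat)%:Z) = gv u by rewrite inz_gv inE.
  by move: bu; case: u {uJK} => [[x hx] [y' hy]]; rewrite mvE /box /grid_vertex /= => bu; congr pair; lia.
have cJK : #|J :&: K| = (#|B| + #|D|)%N.
  rewrite -(cardsID [set u | box n (mv (gv u) west)] (J :&: K)); congr (_ + _)%N; apply: eq_card => u.
    by rewrite !inE.
  by rewrite !inE andbC.
rewrite -(cardsID K J) cJK e1 cAB cD; lia.
Qed.

End OneConfig.

(** [S] is the part on [exits K], [J] is unchanged outside [K], and inside [K] it is recovered by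
    moving back east; only the lost cells of the left column have to be recorded. *)
Lemma shift_injective J S J' S' : compat J K -> compat J' K ->
  S \subset exits K -> S' \subset exits K ->
  shift K J S = shift K J' S' -> leftcol (J :&: K) = leftcol (J' :&: K) -> J = J' /\ S = S'.
Proof.
move=> cJ cJ' SF SF' E EL; split; last by rewrite -(shift_exits J SF) E shift_exits.
apply/setP => u; case: (boolP (u \in K)) => uK; last first.
  by rewrite -(shift_outside cJ SF uK) E shift_outside.
have zK : inz K (gv u) by rewrite inz_gv.
case: (boolP (box n (mv (gv u) west))) => bu.
  by rewrite -!inz_gv (shift_inside cJ SF zK bu) E -shift_inside.
have Eu : gv u = (0, (u.2 : nat)%:Z).
  by move: bu; case: u {uK zK} => [[x hx] [y hy]]; rewrite mvE /box /grid_vertex /= => bu; congr pair; lia.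
have := congr1 (fun D : {set 'I_n} => u.2 \in D) EL.
by rewrite !inE -Eu !inz_gv !inE uK !andbT.
Qed.

(** In each row [K] is a union of intervals. Their right ends are exits, as [K] misses the right
    side; their left ends are entries or lie in the left column. *)
Lemma exits_entries : misses_right K -> #|exits K| = (#|leftcol K| + #|entries K|)%N.
Proof.
move=> mK.
have bE u : u \in K -> box n (mv (gv u) east).
  move/mK; case: u => [[x hx] [y hy]]; rewrite mvE /box /=; lia.
pose A := [set u in K | inz K (mv (gv u) east)].
pose B := [set u in K | inz K (mv (gv u) west)].
pose D := [set u in K | ~~ box n (mv (gv u) west)].
have e1 : #|K| = (#|A| + #|exits K|)%N.
  rewrite -(cardsID [set u | inz K (mv (gv u) east)] K); congr (_ + _)%N; apply: eq_card => u.
    by rewrite !inE.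
  rewrite !inE andbC; case: (boolP (u \in K)) => //= uK; by rewrite bE.
have e2 : #|K| = (#|B| + (#|entries K| + #|D|))%N.
  rewrite -(cardsID [set u | inz K (mv (gv u) west)] K); congr (_ + _)%N.
    by apply: eq_card => u; rewrite !inE.
  rewrite -(cardsID [set u | box n (mv (gv u) west)] (K :\: _)); congr (_ + _)%N; apply: eq_card => u.
    by rewrite !inE; case: (u \in K); case: (box _ _); case: (inz _ _).
  rewrite !inE; case: (u \in K); rewrite ?andbF //= andbT.
  case: (boolP (box _ _)) => //= nb; apply/negP => /inz_box; exact/negP.
have cAB : #|A| = #|B|.
  have inj : {in B &, injective (gmv^~ west)}.
    move=> u v; rewrite !inE => /andP[_ /inz_box bu] /andP[_ /inz_box bv] /(congr1 gv).
    by rewrite !gmvE // => /mv_inj/gv_inj.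
  rewrite -(card_in_imset inj); congr #|pred_of_set _|; apply/setP => w.
  apply/idP/imsetP => [|[u]].
    rewrite inE => /andP[wK /inzP[u uK E]]; exists u.
      by rewrite inE uK E mv_ew inz_gv.
    by apply: gv_inj; rewrite gmvE E mv_ew ?box_gv.
  rewrite !inE => /andP[uK bu] ->; have bu' := inz_box bu.
  by rewrite gmvE // mv_we inz_gv uK -inz_gv gmvE ?bu.
have cD : #|leftcol K| = #|D|.
  have x0 u : u \in D -> u.1 = 0%N :> nat.
    by rewrite inE => /andP[_]; case: u => [[x hx] [y hy]]; rewrite mvE /box /=; lia.
  have inj : {in D &, injective (fun u : G => u.2)}.
    move=> u v uD vD /= h; move: (x0 u uD) (x0 v vD).
    by case: u v h {uD vD} => [u1 u2] [v1 v2] /= -> h1 h2; congr pair; apply: ord_inj; rewrite h1.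
  rewrite -(card_in_imset inj); congr #|pred_of_set _|; apply/setP => y.
  apply/idP/imsetP => [|[u]].
    rewrite inE => /inzP[u uK E]; exists u; last first.
      by apply: ord_inj; case: E => _ ->.
    by rewrite inE uK E mvE /box /=; lia.
  move=> uD ->; have := x0 u uD; move: uD; rewrite !inE => /andP[uK _] hx.
  suff -> : (0, (u.2 : nat)%:Z) = gv u by rewrite inz_gv.
  by rewrite /grid_vertex hx.
lia.
Qed.

Lemma horizontal_split :
  #|[set f in bd K | ~~ f.2.1]| = (#|exits K| + #|entries K|)%N.
Proof.
have -> : [set f in bd K | ~~ f.2.1] = [set (u, east) | u in exits K] :|: [set (u, west) | u in entries K].
  apply/setP => -[u [[] s]]; rewrite !inE /=.
    by rewrite andbF; apply/esym/negP => /orP[] /imsetP[].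
  have mi (d : dir) (X : {set G}) : ((u, d) \in [set (u0, d) | u0 in X]) = (u \in X).
    by apply/imsetP/idP => [[v vX [->]]//|uX]; exists u.
  rewrite andbT bdryE inz_gv; case: s.
    have -> : ((u, (false, true)) \in [set (u0, east) | u0 in exits K]) = false.
      by apply/negP => /imsetP[].
    by rewrite mi inE.
  have -> : ((u, (false, false)) \in [set (u0, west) | u0 in entries K]) = false.
    by apply/negP => /imsetP[].
  by rewrite orbF mi inE.
rewrite cardsU !card_imset => [|x y [] //|x y [] //].
rewrite (_ : _ :&: _ = set0) ?cards0 ?subn0 //.
by apply/setP => f; rewrite !inE; apply/negP => /andP[/imsetP[? _ ->] /imsetP[]].
Qed.

End OneContour.
End Shift.

(** * Weights *)

Lemma sum_subset_weight (R : comPzRingType) (x : R) (T : finType) (F : {set T}) :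
  \sum_(S : {set T} | S \subset F) x ^+ #|S| = (1 + x) ^+ #|F|.
Proof.
have -> : (1 + x) ^+ #|F| = \prod_i (((i \in F)%:R * x) + 1).
  rewrite -prodr_const big_mkcond; apply: eq_bigr => i _.
  by case: (i \in F); rewrite ?mul1r ?mul0r ?add0r // addrC.
rewrite bigA_distr big_mkcond; apply: eq_bigr => S _.
case: (boolP (S \subset F)) => [SF|/subsetPn[i iS iF]].
  rewrite -prodr_const big_mkcond; apply: eq_bigr => i _.
  by case: (boolP (i \in S)) => // iS; rewrite (subsetP SF) // mul1r.
by rewrite (bigD1 i) //= iS (negbTE iF) !mul0r.
Qed.

(** * Hard-core weight of a set of positions on a path *)

Section PathWeight.
Variables (R : realFieldType) (lambda theta : R) (n : nat).
Hypothesis lambda_gt0 : 0 < lambda.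
Hypothesis theta_ge1 : 1 <= theta.
Hypothesis theta2 : theta ^+ 2 = theta + lambda.

Definition has_nat (D : {set 'I_n}) (k : nat) := [exists y in D, nat_of_ord y == k].
Definition sparse (D : {set 'I_n}) := [forall y in D, ~~ has_nat D y.+1].
(** The number of maximal runs of [Y] that end before the last position. *)
Definition gaps (Y : {set 'I_n}) := #|[set y : 'I_n | (y \notin Y) && (0 < y)%N && has_nat Y y.-1]|.

Lemma has_nat_ord (D : {set 'I_n}) (y : 'I_n) : has_nat D y = (y \in D).
Proof.
apply/existsP/idP => [[y' /andP[h /eqP /ord_inj <-]]//|h]; by exists y; rewrite h eqxx.
Qed.

Lemma has_natP (D : {set 'I_n}) k : reflect (exists2 y, y \in D & nat_of_ord y = k) (has_nat D k).
Proof.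
apply: (iffP existsP) => [[y /andP[h /eqP]]|[y h e]]; exists y => //.
by rewrite h e eqxx.
Qed.

Variable Y : {set 'I_n}.

Let last_in D k := (0 < k)%N && has_nat D k.-1.
Let good k (D : {set 'I_n}) := [&& D \subset Y, sparse D & [forall y in D, (y < k)%N]].
Let phi k := \sum_(D : {set 'I_n} | good k D) lambda ^+ #|D| * (if last_in D k then 1 else theta).
(** Exponent of [theta] paid at position [k]: one inside [Y], and one just after a run, where the
    weight may return from [1] to [theta]. *)
Let a k := (has_nat Y k + (~~ has_nat Y k && last_in Y k))%N.

Lemma theta_gt0 : 0 < theta. Proof. exact: lt_le_trans theta_ge1. Qed.

(* The weights [theta] and [1] in [phi] are the entries of a left eigenvector of the
   transfer matrix of the path. *)
Lemma phi_step k : (k < n)%N -> phi k.+1 <= phi k * theta ^+ a k.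
Proof.
move=> kn; pose o := Ordinal kn; have t0 := theta_gt0.
have okD (D : {set 'I_n}) : has_nat D k = (o \in D) by rewrite -(has_nat_ord D o).
have lt_last D : good k D -> o \notin D.
  by case/and3P => _ _ /forall_inP h; apply/negP => /h; rewrite /= ltnn.
have goodS (D : {set 'I_n}) : o \notin D -> good k.+1 D = good k D.
  move=> oD; congr [&& _, _ & _]; apply: eq_forallb_in => y yD.
  rewrite ltnS leq_eqVlt; case: eqP => // yk; exfalso.
  by move/negP: oD; apply; rewrite -okD; apply/has_natP; exists y.
rewrite /phi (bigID (fun D : {set 'I_n} => o \in D)) /=.
have e1 : \sum_(D : {set 'I_n} | good k.+1 D && (o \notin D)) lambda ^+ #|D| * (if last_in D k.+1 then 1 else theta)
   = \sum_(D : {set 'I_n} | good k D) lambda ^+ #|D| * theta.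
  apply: eq_big => [D|D /andP[_ oD]]; last by rewrite /last_in /= okD (negbTE oD).
  case: (boolP (o \in D)) => oD; last by rewrite andbT goodS.
  by rewrite andbF; apply/esym/negP => /lt_last; rewrite oD.
rewrite e1.
case: (boolP (o \in Y)) => oY; last first.
  rewrite big1 ?add0r; last first.
    by move=> D /andP[/and3P[/subsetP DY _ _] /DY]; rewrite (negbTE oY).
  rewrite mulr_suml; apply: ler_sum => D gD; rewrite -mulrA ler_pM2l ?exprn_gt0 //.
  rewrite /a okD (negbTE oY) add0n /=; case: ifP => lD.
    have -> : last_in Y k = true.
      move: lD; rewrite /last_in => /andP[-> /has_natP[y yD <-]] /=.
      by rewrite has_nat_ord; case/and3P: gD => /subsetP ->.
    by rewrite mul1r expr1.
  by rewrite ler_peMr ?(ltW t0) // exprn_ege1.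
have -> : a k = 1%N by rewrite /a okD oY.
rewrite expr1.
have e2 : \sum_(D : {set 'I_n} | good k.+1 D && (o \in D)) lambda ^+ #|D| * (if last_in D k.+1 then 1 else theta)
   <= \sum_(D : {set 'I_n} | good k D && ~~ last_in D k) lambda ^+ #|D| * lambda.
  rewrite (reindex_onto (fun D : {set 'I_n} => o |: D) (fun D : {set 'I_n} => D :\ o)) /=; last first.
    by move=> D /andP[_ oD]; rewrite setD1K.
  rewrite big_mkcond [leRHS]big_mkcond; apply: ler_sum => D _.
  case: ifP => [/andP[/andP[gD _] /eqP oD]|_]; last first.
    by case: ifP => // _; rewrite mulr_ge0 ?exprn_ge0 // ltW.
  have {}oD : o \notin D by rewrite -oD !inE eqxx.
  have /and3P[/subUsetP[_ DY] /forall_inP sD /forall_inP lD] := gD.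
  have sub (D' : {set 'I_n}) k' : D' \subset o |: D -> has_nat D' k' -> has_nat (o |: D) k'.
    by move=> /subsetP h /has_natP[y yD <-]; apply/has_natP; exists y => //; exact: h.
  have -> : good k D && ~~ last_in D k.
    rewrite -(goodS _ oD); apply/andP; split; last first.
      apply/negP => /andP[k0 /has_natP[y yD yk]].
      have /negP := sD y (setU1r _ yD); apply; rewrite yk prednK //.
      by rewrite okD !inE eqxx.
    apply/and3P; split=> //.
      apply/forall_inP => y yD; apply: contra (sD y (setU1r _ yD)).
      by apply: sub; exact: subsetUr.
    by apply/forall_inP => y yD; apply: lD; exact: setU1r.
  rewrite /last_in /= okD !inE eqxx /= mulr1 cardsU1 oD add1n exprSr //.
(* Sets containing [k - 1] cannot be extended by [k] and go from weight [1] to [theta]; the others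
   go from [theta] to [lambda + theta = theta ^+ 2]. *)
apply: le_trans (lerD e2 (lexx _)) _.
rewrite [X in _ + X](bigID (fun D => last_in D k))  /= [X in _ <= X * _](bigID (fun D => last_in D k)) /=.
rewrite addrCA mulrDl.
apply: lerD.
  by rewrite mulr_suml; apply: ler_sum => D /andP[_ ->]; rewrite mulr1.
rewrite -big_split /= mulr_suml; apply: ler_sum => D /andP[_ /negbTE ->].
by rewrite -mulrDr [lambda + _]addrC -theta2 -mulrA expr2.
Qed.

(** The one-step bounds are multiplied, starting from [phi 0 = theta], which is the extra factor;
    the final weights [1] and [theta] are at least [1]. *)
Lemma path_weight :
  \sum_(D : {set 'I_n} | (D \subset Y) && sparse D) lambda ^+ #|D| <= theta ^+ (#|Y| + gaps Y).+1.
Proof.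
have t0 := theta_gt0.
have step k : (k <= n)%N -> phi k <= theta ^+ (\sum_(i < k) a i).+1.
  elim: k => [_|k IH kn].
    rewrite big_ord0 expr1 /phi (bigD1 set0) /=; last first.
      rewrite /good sub0set /=; apply/andP; split; apply/forall_inP => y; by rewrite inE.
    rewrite cards0 expr0 mul1r big1 ?addr0 // => D /andP[/and3P[_ _ /forall_inP h] D0].
    by case/set0Pn: D0 => y /h.
  apply: le_trans (phi_step kn) _; rewrite big_ord_recr /= -addSn exprD.
  by rewrite ler_pM2r ?exprn_gt0 // IH // ltnW.
have <- : (\sum_(i < n) a i = #|Y| + gaps Y)%N.
  rewrite big_split /= -sum1_card /gaps -sum1_card; congr (_ + _)%N.
    by rewrite [RHS]big_mkcond; apply: eq_bigr => i _; rewrite has_nat_ord; case: (_ \in _).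
  rewrite [RHS]big_mkcond; apply: eq_bigr => i _; rewrite inE has_nat_ord -andbA.
  by case: (_ && _).
apply: le_trans (step n (leqnn n)); rewrite /phi [leRHS](eq_bigl (fun D : {set 'I_n} => (D \subset Y) && sparse D)).
  apply: ler_sum => D _; rewrite ler_peMr ?exprn_ge0 ?(ltW lambda_gt0) //.
  by case: ifP.
move=> D; rewrite /good; have -> : [forall y in D, (y < n)%N] by apply/forall_inP.
by rewrite andbT.
Qed.

End PathWeight.

(** * Peierls estimate *)

Lemma sum_injective_le (R : numDomainType) (X Y : finType) (A : {set X}) (B : {set Y})
    (f : X -> Y) (w : Y -> R) :
  {in A &, injective f} -> (forall x, x \in A -> f x \in B) -> (forall y, 0 <= w y) ->
  \sum_(x in A) w (f x) <= \sum_(y in B) w y.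
Proof.
move=> inj fB w0; rewrite -(big_imset _ inj) /=.
rewrite [leRHS](bigID (mem [set f x | x in A])) /=.
rewrite [X in X + _](eq_bigl (mem [set f x | x in A])) /=; last first.
  move=> y; rewrite andb_idl //; case/imsetP => x xA ->; exact: fB.
by rewrite lerDl; apply: sumr_ge0.
Qed.

Section ShiftWeight.
Variables (R : realType) (lambda theta : R) (n : nat).
Hypothesis lambda_gt0 : 0 < lambda.
Hypothesis theta_ge1 : 1 <= theta.
Hypothesis theta2 : theta ^+ 2 = theta + lambda.
Local Notation G := (grid n).
Local Notation gv := (@grid_vertex n).
Local Notation T := (indset (@grid_adj n)).
Implicit Types (K J S : {set G}) (I : T).

Lemma indset_independent I : independent (@grid_adj n) (val I).
Proof. exact: (valP I). Qed.

Variables (b : bool) (K : {set G}).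
Hypothesis tK : typed b K.

Lemma sparse_leftcol J : independent (@grid_adj n) J -> sparse (leftcol (J :&: K)).
Proof.
move=> /independentP iJ; apply/forall_inP => y; rewrite inE inzI => /andP[yJ _].
apply/negP => /has_natP[y']; rewrite inE inzI => /andP[y'J _] E.
apply: (iJ (0, y%:Z) (true, false) yJ).
by move: y'J; rewrite E mvE /=; congr (inz J (_, _)); lia.
Qed.

Lemma leftcol_sub J : leftcol (J :&: K) \subset leftcol K.
Proof. by apply/subsetP => y; rewrite !inE inzI => /andP[]. Qed.

Variable Q : pred T.
Hypothesis closed_shift : forall I I' S, Q I -> compat (val I) K -> S \subset exits K ->
  val I' = shift K (val I) S -> Q I'.

(** A configuration with a set [S] is sent to the shifted configuration with the lost part of the
    left column. This map is injective, preserves the product weight and keeps [Q]. *)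
Lemma shift_weight :
  (\sum_(I : T | Q I && `[< compat (val I) K >]) lambda ^+ #|val I|) * (1 + lambda) ^+ #|exits K|
  <= (\sum_(I : T | Q I) lambda ^+ #|val I|) *
     \sum_(D : {set 'I_n} | (D \subset leftcol K) && sparse D) lambda ^+ #|D|.
Proof.
rewrite -sum_subset_weight.
pose A := [set x : T * {set G} | (Q x.1 && `[< compat (val x.1) K >]) && (x.2 \subset exits K)].
pose B := [set y : T * {set 'I_n} | Q y.1 && ((y.2 \subset leftcol K) && sparse y.2)].
pose f (x : T * {set G}) : T * {set 'I_n} :=
  (insubd x.1 (shift K (val x.1) x.2), leftcol (val x.1 :&: K)).
pose w (y : T * {set 'I_n}) := lambda ^+ #|val y.1| * lambda ^+ #|y.2|.
have valf x : x \in A -> val (f x).1 = shift K (val x.1) x.2.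
  rewrite inE => /andP[/andP[_ /asboolP cx] sx]; rewrite /f val_insubd.
  by rewrite (shift_independent tK cx sx (indset_independent x.1)).
have -> : (\sum_(I : T | Q I && `[< compat (val I) K >]) lambda ^+ #|val I|) *
   (\sum_(S : {set G} | S \subset exits K) lambda ^+ #|S|) = \sum_(x in A) w (f x).
  rewrite big_distrlr pair_big /=; apply: eq_big => x; first by rewrite inE.
  move=> hx; have xA : x \in A by rewrite inE.
  rewrite /w (valf _ xA) -!exprD /f /=; congr (_ ^+ _).
  case/andP: hx => /andP[_ /asboolP cx] sx.
  exact/esym/(card_shift cx sx (indset_independent x.1)).
have -> : (\sum_(I : T | Q I) lambda ^+ #|val I|) *
     (\sum_(D : {set 'I_n} | (D \subset leftcol K) && sparse D) lambda ^+ #|D|) =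
     \sum_(y in B) w y.
  by rewrite big_distrlr pair_big /=; apply: eq_bigl => y; rewrite inE.
apply: sum_injective_le => [x x' xA x'A E|x xA|y].
- have E1 : shift K (val x.1) x.2 = shift K (val x'.1) x'.2 by rewrite -!valf // E.
  have E2 := congr1 snd E; rewrite /= in E2.
  move: xA x'A; rewrite !inE => /andP[/andP[_ /asboolP cx] sx] /andP[/andP[_ /asboolP cx'] sx'].
  have [/val_inj h1 h2] := shift_injective cx cx' sx sx' E1 E2.
  by case: x x' h1 h2 {E E1 E2 cx cx' sx sx'} => [? ?] [? ?] /= -> ->.
- have v := valf x xA; move: xA; rewrite !inE => /andP[/andP[Qx /asboolP cx] sx].
  rewrite (closed_shift Qx cx sx v) leftcol_sub sparse_leftcol //.
  exact: indset_independent.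
- by rewrite mulr_ge0 // exprn_ge0 // ltW.
Qed.

Hypothesis cG : conn [set: G].
Hypothesis csK : contour_set b K.

(** At the upper end of a run in the left column the contour heads west, off the grid; by
    [unique_exit] this happens at most once. *)
Lemma gaps_leftcol : (gaps (leftcol K) <= 1)%N.
Proof.
have exit_of (y : 'I_n) : (y \notin leftcol K) && (0 < y)%N && has_nat (leftcol K) y.-1 ->
    bdry K ((0, y%:Z - 1), (true, false)) && ~~ bdry K (nxt K ((0, y%:Z - 1), (true, false))).
  move=> /andP[/andP[yK y0] /has_natP[y' y'K E]].
  rewrite !inE in yK y'K.
  have be : bdry K ((0, y%:Z - 1), (true, false)).
    rewrite bdryE mvE /= subrK yK andbT; apply/andP; split.
      by move: y'K; rewrite E; congr (inz K (_, _)); lia.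
    by have := ltn_ord y; rewrite /box /=; lia.
  by rewrite be (bdry_nxt tK be) mvE /box /=; lia.
rewrite /gaps; apply/card_le1_eqP => y y'.
rewrite in_set => /exit_of/andP[b1 n1]; rewrite in_set => /exit_of/andP[b2 n2].
have [] := unique_exit cG csK b1 b2 n1 n2.
by move=> E; apply: ord_inj; lia.
Qed.

(** With [a = #|leftcol K|] and [f = #|entries K|], the gain is [(1 + lambda) ^+ (a + f)], the loss
    at most [theta ^+ (a + 2)], and [l <= 2 * a + 4 * f]. The assumptions on [M ^+ 2] and [M ^+ 4]
    are raised to the powers [a] and [f] and multiplied. *)
Lemma contour_weight (M rho : R) (l : nat) : misses_right K ->
  1 <= M -> 0 < rho -> rho <= 1 ->
  M ^+ 2 * theta <= rho ^+ 2 * (1 + lambda) -> M ^+ 4 <= rho ^+ 4 * (1 + lambda) ->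
  #|bd K| = l.+1 ->
  (\sum_(I : T | Q I && `[< compat (val I) K >]) lambda ^+ #|val I|) * M ^+ l
  <= rho ^+ l * (theta ^+ 2 * \sum_(I : T | Q I) lambda ^+ #|val I|).
Proof.
move=> mK M1 r0 r1 h1 h2 hl.
set W := \sum_(I : T | _) _; set Z := \sum_(I : T | _) _.
have Z0 : 0 <= Z by apply: sumr_ge0 => I _; rewrite exprn_ge0 // ltW.
have l1 : 0 < 1 + lambda by rewrite addr_gt0.
have t0 : 0 < theta by apply: lt_le_trans theta_ge1.
have M0 : 0 < M by apply: lt_le_trans M1.
have hx := exits_entries mK.
have hv := bd_le_horizontal cG csK; rewrite horizontal_split hl hx in hv.
set a := #|leftcol K| in hx hv; set f := #|entries K| in hx hv.
have hl2 : (l <= 2 * a + 4 * f)%N by move: hv; clear; lia.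
have s1 : W * (1 + lambda) ^+ (a + f) <= Z * theta ^+ (a + 2).
  rewrite -hx; apply: le_trans shift_weight _; rewrite ler_wpM2l //.
  apply: le_trans (path_weight lambda_gt0 theta_ge1 theta2 _) _.
  by apply: ler_weXn2l => //; rewrite -/a addn2 ltnS -addn1 leq_add2l gaps_leftcol.
move: W Z Z0 s1 {hl hx} => W Z Z0 s1.
have s2 : theta ^+ a * M ^+ l <= rho ^+ l * (1 + lambda) ^+ (a + f).
  apply: (@le_trans _ _ (theta ^+ a * M ^+ (2 * a + 4 * f))).
    by rewrite ler_pM2l ?exprn_gt0 // ler_weXn2l.
  apply: (@le_trans _ _ (rho ^+ (2 * a + 4 * f) * (1 + lambda) ^+ (a + f))); last first.
    rewrite ler_pM2r ?exprn_gt0 //; apply: ler_wiXn2l => //; exact: ltW.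
  have Ex (x : R) : x ^+ (2 * a + 4 * f) = (x ^+ 2) ^+ a * (x ^+ 4) ^+ f.
    by rewrite exprD !exprM.
  rewrite !Ex (exprD (1 + lambda) a f) mulrA -(exprMn a theta) (mulrC theta).
  rewrite [X in _ <= X]mulrACA -(exprMn a (rho ^+ 2)) -(exprMn f (rho ^+ 4)).
  apply: ler_pM; rewrite ?exprn_ge0 ?mulr_ge0 ?exprn_ge0 ?(ltW t0) ?(ltW M0) //.
    by apply: lerXn2r; rewrite ?nnegrE ?mulr_ge0 ?exprn_ge0 ?(ltW t0) ?(ltW M0) ?(ltW l1) ?(ltW r0).
  by apply: lerXn2r; rewrite ?nnegrE ?mulr_ge0 ?exprn_ge0 ?(ltW t0) ?(ltW M0) ?(ltW l1) ?(ltW r0).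
rewrite -(ler_pM2r (exprn_gt0 (a + f) l1)) mulrAC.
apply: le_trans (ler_wpM2r (exprn_ge0 l (ltW M0)) s1) _.
have -> : Z * theta ^+ (a + 2) * M ^+ l = theta ^+ 2 * Z * (theta ^+ a * M ^+ l).
  by rewrite exprD; ring.
have -> : rho ^+ l * (theta ^+ 2 * Z) * (1 + lambda) ^+ (a + f) =
   theta ^+ 2 * Z * (rho ^+ l * (1 + lambda) ^+ (a + f)) by ring.
by rewrite ler_wpM2l // mulr_ge0 // exprn_ge0 // ltW.
Qed.

End ShiftWeight.

Section Peierls.
Variables (R : realType) (lambda theta M rho B : R) (n : nat).
Hypothesis lambda_gt0 : 0 < lambda.
Hypothesis theta_ge1 : 1 <= theta.
Hypothesis theta2 : theta ^+ 2 = theta + lambda.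
Hypothesis M_ge1 : 1 <= M.
Hypothesis rho_gt0 : 0 < rho.
Hypothesis rho_le1 : rho <= 1.
Hypothesis M2 : M ^+ 2 * theta <= rho ^+ 2 * (1 + lambda).
Hypothesis M4 : M ^+ 4 <= rho ^+ 4 * (1 + lambda).
Hypothesis B_gt0 : 0 < B.
Hypothesis growth : forall m, (taxi_count m)%:R <= B * M ^+ m.
Local Notation G := (grid n).
Local Notation gv := (@grid_vertex n).
Local Notation T := (indset (@grid_adj n)).
Implicit Types (K J S : {set G}) (I : T).

Definition long_contour (b : bool) (m : nat) J K : Prop :=
  [/\ contour_set b K, misses_right K, compat J K & (m < #|bd K|)%N].

Definition faulty (b : bool) (m : nat) J := `[< exists K, long_contour b m J K >].

Lemma card_bd_le K : (#|bd K| <= 4 * n ^ 2)%N.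
Proof.
have -> : (4 * n ^ 2 = #|{: G * dir}|)%N.
  by rewrite !card_prod card_bool card_ord; lia.
exact: max_card.
Qed.

(** Union bound over contours, grouped by length. There are at most [4 * n ^ 2 * B * M ^ l] contours
    of [l + 1] edges, each of relative weight at most [theta ^ 2 * rho ^ l / M ^ l]. At most
    [4 * n ^ 2] values of [l] occur, all at least [m]. *)
Lemma peierls b m (Q : pred T) : conn [set: G] ->
  (forall K I I' S, long_contour b m (val I) K -> Q I -> S \subset exits K ->
     val I' = shift K (val I) S -> Q I') ->
  \sum_(I : T | Q I && faulty b m (val I)) lambda ^+ #|val I| <=
  16 * n%:R ^+ 4 * B * theta ^+ 2 * rho ^+ m * \sum_(I : T | Q I) lambda ^+ #|val I|.
Proof.
move=> cG cQ; set Z := \sum_(I : T | Q I) _.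
have Z0 : 0 <= Z by apply: sumr_ge0 => I _; rewrite exprn_ge0 // ltW.
have M0 : 0 < M by apply: lt_le_trans M_ge1.
have t0 : 0 < theta by apply: lt_le_trans theta_ge1.
pose W K := \sum_(I : T | Q I && `[< compat (val I) K >]) lambda ^+ #|val I|.
have W0 K : 0 <= W K by apply: sumr_ge0 => I _; rewrite exprn_ge0 // ltW.
pose X K := [&& `[< contour_set b K >], `[< misses_right K >] & (m < #|bd K|)%N].
have WX K l : X K -> #|bd K| = l.+1 -> W K <= rho ^+ l / M ^+ l * (theta ^+ 2 * Z).
  move=> /and3P[/asboolP csK /asboolP mK mb] hl.
  have := @contour_weight R lambda theta n lambda_gt0 theta_ge1 theta2 b K (cs_typed csK)
    Q _ cG csK M rho l mK M_ge1 rho_gt0 rho_le1 M2 M4 hl.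
  rewrite -/Z -/(W K) -ler_pdivlMr ?exprn_gt0 // => h.
  by rewrite [X in _ <= X]mulrAC; apply: h => I I' S QI cI; exact: cQ.
have N (l : nat) : (\sum_(K | X K && (#|bd K| == l.+1)) W K) <=
   (m <= l)%N%:R * (4 * n%:R ^+ 2 * B * theta ^+ 2 * Z * rho ^+ l).
  case: (leqP m l) => ml; last first.
    by rewrite mul0r big1 // => K /andP[/and3P[_ _ mb] /eqP hl]; rewrite hl ltnS leqNgt ml in mb.
  rewrite mul1r.
  apply: (@le_trans _ _ (\sum_(K in [set K : {set G} | `[< contour_set b K >] && (#|bd K| == l.+1)])
     rho ^+ l / M ^+ l * (theta ^+ 2 * Z))).
    rewrite big_mkcond [leRHS]big_mkcond /=; apply: ler_sum => K _; rewrite inE.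
    have r0 : 0 <= rho ^+ l / M ^+ l * (theta ^+ 2 * Z).
      by rewrite !mulr_ge0 ?invr_ge0 ?exprn_ge0 ?(ltW t0) ?(ltW M0) ?(ltW rho_gt0).
    case: ifP => [/andP[XK hl]|_]; last by case: ifP.
    by case/and3P: (XK) => -> _ _; rewrite hl /=; apply: WX => //; exact/eqP.
  rewrite sumr_const -[leLHS]mulr_natl.
  have c0 : (#|[set K : {set G} | `[< contour_set b K >] & #|bd K| == l.+1]|%:R <= 4 * n%:R ^+ 2 * (B * M ^+ l) :> R).
    apply: (@le_trans _ _ (4 * n ^ 2 * taxi_count l)%:R); first by rewrite ler_nat card_contour_sets.
    by rewrite 2!natrM natrX ler_wpM2l ?mulr_ge0 ?exprn_ge0.
  apply: (@le_trans _ _ (4 * n%:R ^+ 2 * (B * M ^+ l) * (rho ^+ l / M ^+ l * (theta ^+ 2 * Z)))).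
    rewrite ler_wpM2r // !mulr_ge0 ?invr_ge0 ?exprn_ge0 ?(ltW t0) ?(ltW M0) ?(ltW rho_gt0) //.
  rewrite le_eqVlt; apply/orP; left; apply/eqP.
  by have Ml : M ^+ l != 0 by [rewrite expf_neq0 // gt_eqF]; field.
apply: (@le_trans _ _ (\sum_(K | X K) W K)).
  rewrite /W; under [leRHS]eq_bigr do rewrite big_mkcond.
  rewrite exchange_big /= big_mkcond; apply: ler_sum => I _.
  case: ifP => [/andP[QI /asboolP[K [csK mK cK mb]]]|_].
    rewrite (bigD1 K) /=; last by rewrite /X mb; apply/and3P; split=> //; exact/asboolP.
    rewrite QI; case: asboolP => // _; rewrite lerDl; apply: sumr_ge0 => K' _.
    by case: ifP => // _; rewrite exprn_ge0 // ltW.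
  by apply: sumr_ge0 => K' _; case: ifP => // _; rewrite exprn_ge0 // ltW.
apply: (@le_trans _ _ (\sum_(l < 4 * n ^ 2) \sum_(K | X K && (#|bd K| == l.+1)) W K)).
  under [leRHS]eq_bigr do rewrite big_mkcond.
  rewrite exchange_big /= big_mkcond; apply: ler_sum => K _.
  case: ifP => XK; last by rewrite sumr_ge0 // => l _; case: ifP.
  have bK : (0 < #|bd K|)%N by case/and3P: XK => _ _; apply: leq_trans.
  have hl : (#|bd K|.-1 < 4 * n ^ 2)%N by rewrite prednK // card_bd_le.
  rewrite (bigD1 (Ordinal hl)) //= prednK // eqxx /= lerDl sumr_ge0 // => l _.
  by case: ifP.
have C0 : 0 <= 4 * n%:R ^+ 2 * B * theta ^+ 2 * Z.
  by rewrite !mulr_ge0 ?exprn_ge0 ?(ltW t0) ?(ltW B_gt0).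
apply: (@le_trans _ _ (\sum_(l < 4 * n ^ 2) 4 * n%:R ^+ 2 * B * theta ^+ 2 * Z * rho ^+ m)).
  apply: ler_sum => l _; apply: le_trans (N l) _.
  case: (leqP m l) => ml; last by rewrite mul0r mulr_ge0 // exprn_ge0 // ltW.
  by rewrite mul1r ler_wpM2l //; apply: ler_wiXn2l => //; exact: ltW.
rewrite sumr_const card_ord -[leLHS]mulr_natr natrM natrX le_eqVlt.
by apply/orP; left; apply/eqP; ring.
Qed.

End Peierls.

(** * Existence of long contours *)

Section Existence.
Variable n : nat.
Local Notation G := (grid n).
Local Notation gv := (@grid_vertex n).
Implicit Types (K C J S : {set G}) (z : Z2) (d : dir) (u v w x y : G).

Lemma adj_sym_grid u v : grid_adj u v = grid_adj v u.
Proof. rewrite /grid_adj /Z2_adj; lia. Qed.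

Lemma gin_sym K : symmetric (gin K).
Proof. by move=> u v; rewrite /gin adj_sym_grid [(v \in K) && _]andbC. Qed.

Lemma typedP b K : typed b K <->
  (forall u v, grid_adj u v -> u \in K -> v \notin K -> par (gv u) = ~~ b).
Proof.
split=> [tK u v /adjP[d E] uK vK|h z d /inzP[u uK <-] /boxP[v E] vK].
  by apply: (tK _ d); rewrite -?E ?inz_gv ?box_gv.
by apply: (h u v) => //; [apply/adjP; exists d | rewrite -inz_gv E].
Qed.

Lemma compatP J K : compat J K <->
  (forall u v, grid_adj u v -> u \in K -> v \notin K -> (u \notin J) && (v \notin J)).
Proof.
split=> [cK u v /adjP[d E] uK vK|h z d /inzP[u uK <-] /boxP[v E] vK].
  by have := @cK (gv u) d; rewrite -E !inz_gv box_gv; apply.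
by rewrite -E !inz_gv; apply: h => //; [apply/adjP; exists d | rewrite -inz_gv E].
Qed.

Lemma adj_col u v : grid_adj u v -> (v.1 <= u.1.+1)%N /\ (u.1 <= v.1.+1)%N.
Proof. rewrite /grid_adj /Z2_adj /=; lia. Qed.

Lemma nat_const (f : nat -> bool) : (forall k : nat, (k.+1 < n)%N -> f k = f k.+1) ->
  forall k : nat, (k < n)%N -> f k = f 0%N.
Proof. by move=> h; elim=> // k IH hk; rewrite -h // IH // ltnW. Qed.


Lemma conn_grid : conn [set: G].
Proof.
have half u : forall k v, (`|(u.1 : nat)%:Z - (v.1 : nat)%:Z| + `|(u.2 : nat)%:Z - (v.2 : nat)%:Z|)%N = k ->
  connect (gin [set: G]) u v.
  elim=> [|k IH] v hk.
    rewrite (_ : v = u) //; case: u v hk => [u1 u2] [v1 v2] /= hk.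
    by congr pair; apply: ord_inj; lia.
  have [d bd hd] : exists2 d, box n (mv (gv v) d) &
     (`|(u.1 : nat)%:Z - (mv (gv v) d).1| + `|(u.2 : nat)%:Z - (mv (gv v) d).2|)%N = k.
    case: u v hk {IH} => [[u1 h1] [u2 h2]] [[v1 g1] [v2 g2]] hk; rewrite /= in hk.
    have [c|[c|[c|c]]] : (u1 < v1)%N \/ (v1 < u1)%N \/ (u2 < v2)%N \/ (v2 < u2)%N by lia.
    - by exists (false, true); rewrite mvE /box /=; lia.
    - by exists (false, false); rewrite mvE /box /=; lia.
    - by exists (true, true); rewrite mvE /box /=; lia.
    - by exists (true, false); rewrite mvE /box /=; lia.
  have E := gmvE bd; have := IH (gmv v d); rewrite -E in hd => /(_ hd) h.
  apply: connect_trans h (connect1 _); rewrite /gin !inE andbT adj_sym_grid.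
  by rewrite andbT; apply/adjP; exists d.
by move=> u v _ _; exact: half.
Qed.

(** * Filling the holes of a connected set *)

Section ContourOf.
Variables (b : bool) (J C : {set G}).
Hypothesis n2 : (1 < n)%N.
Hypothesis cC : conn C.
Hypothesis card_C : (1 < #|C|)%N.
Hypothesis tC : typed b C.
Hypothesis jC : compat J C.
Hypothesis mC : misses_right C.

Let n0 : (0 < n)%N. Proof. exact: ltnW. Qed.
Let n1 : (n.-1 < n)%N. Proof. by rewrite prednK. Qed.
Let r (y : 'I_n) : G := (Ordinal n1, y).
Let r0 : G := r (Ordinal n0).
Let E := [set v | connect (gin (~: C)) r0 v].

Let rC (y : 'I_n) : r y \notin C.
Proof. by apply/negP => /mC /=; rewrite prednK // ltnn. Qed.

Let E_out v : v \in E -> v \notin C.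
Proof.
rewrite inE => h; apply: (connect_ind (P := fun v => v \notin C)) h _; last exact: rC.
by move=> x y /and3P[_ _]; rewrite inE.
Qed.

Let E_step x y : x \in E -> y \notin C -> grid_adj x y -> y \in E.
Proof.
move=> xE yC xy; have xC := E_out xE; move: xE; rewrite !inE => /connect_trans; apply.
by apply: connect1; rewrite /gin xy !inE xC yC.
Qed.

Let rE (y : 'I_n) : r y \in E.
Proof.
have h (k : nat) (hk : (k < n)%N) : r (Ordinal hk) \in E.
  elim: k hk => [|k IH] hk; first by rewrite inE (_ : r _ = r0) //; congr pair; exact: val_inj.
  apply: E_step (IH (ltnW hk)) (rC _) _.
  by apply/adjP; exists (true, false); rewrite mvE /grid_vertex /=; congr pair; lia.
by case: y => k hk; exact: h.
Qed.

Let conn_E : conn E.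
Proof.
have h v : v \in E -> connect (gin E) r0 v.
  move=> vE; have := vE; rewrite inE => c.
  suff : v \in E /\ connect (gin E) r0 v by case.
  apply: (connect_ind (P := fun v => v \in E /\ connect (gin E) r0 v)) c _ => [x y /and3P[xy _]|].
    rewrite inE => yC [xE cx]; have yE := E_step xE yC xy; split=> //.
    by apply: connect_trans cx (connect1 _); rewrite /gin xy xE yE.
  by split; [exact: rE | exact: connect0].
move=> u v uE vE; apply: connect_trans (h v vE).
by rewrite (sym_connect_sym (gin_sym E)); exact: h.
Qed.

(** [K] is the complement of [E], the component of the right side in the complement of [C]. Every
    boundary edge of [K] is one of [C], so type and compatibility are inherited. *)
Lemma contour_of : exists K, [/\ contour_set b K, misses_right K, compat J K & C \subset K].
Proof.
have CE : C \subset ~: E.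
  by apply/subsetP => x xC; rewrite inE; apply/negP => /E_out; rewrite xC.
have bdC x y : x \in ~: E -> y \notin ~: E -> grid_adj x y -> x \in C /\ y \notin C.
  rewrite inE => xE; rewrite inE negbK => yE xy; split; last exact: E_out.
  apply: contraT => xC; have := E_step yE xC; rewrite adj_sym_grid => /(_ xy).
  by rewrite (negbTE xE).
exists (~: E); split=> //.
- split.
  + by apply/typedP => u v uv uE vE; have [uC vC] := bdC u v uE vE uv; exact: (proj1 (typedP b C)) uv uC vC.
  + have /card_gt0P[c0 c0C] : (0 < #|C|)%N by exact: ltnW.
    (* A grid path from [c0] may pass through [E], but it comes back to [~: E] at a cell of [C], and
       [C] is connected. *)
    have h w : w \in ~: E -> connect (gin (~: E)) c0 w.
      apply: (connect_ind (P := fun w => w \in ~: E -> connect (gin (~: E)) c0 w))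
        (conn_grid (in_setT c0) (in_setT w)) _ => [x y /and3P[xy _ _] hx yE|_]; last exact: connect0.
      case: (boolP (x \in ~: E)) => xE.
        by apply: connect_trans (hx xE) (connect1 _); rewrite /gin xy xE yE.
      have [yC _] := bdC y x yE xE (etrans (adj_sym_grid y x) xy).
      apply: (connect_sub _ (cC c0C yC)) => p q /and3P[pq pC qC].
      by apply: connect1; rewrite /gin pq !(subsetP CE).
    move=> u v uE vE; apply: connect_trans (h v vE).
    by rewrite (sym_connect_sym (gin_sym _)); exact: h.
  + by rewrite finset.setCK; exact: conn_E.
  + by apply: leq_trans card_C (subset_leq_card CE).
  + rewrite finset.setCK; apply/card_gt1P; exists (r (Ordinal n0)), (r (Ordinal n2)).
    by split; rewrite ?rE //; apply/eqP => -[].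
- move=> u; rewrite inE => uE; rewrite ltnNge; apply/negP => h.
  have Eu : u = r u.2.
    by case: u h {uE} => [[a ha] c] /= h; congr pair; apply: ord_inj => /=; lia.
  by rewrite Eu rE in uE.
- apply/compatP => u v uv uE vE; have [uC vC] := bdC u v uE vE uv.
  exact: (proj1 (compatP J C)) uv uC vC.
Qed.

End ContourOf.

(** Each row is inside [K] in column [a] and outside on the right side, so it has a horizontal
    boundary edge. *)
Lemma full_column_length K (a : nat) : misses_right K -> (a < n)%N ->
  (forall k : nat, (k < n)%N -> inz K (a%:Z, k%:Z)) -> (n <= #|bd K|)%N.
Proof.
move=> mK an col.
have ex (k : 'I_n) : exists2 f, f \in bd K & f.1.2 = k.
  apply: contrapT => no.
  have step (i : nat) : (i.+1 < n)%N -> inz K (i%:Z, (k : nat)%:Z) -> inz K (i.+1%:Z, (k : nat)%:Z).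
    move=> hi /inzP[u uK Eu]; apply: contraT => nk; exfalso; apply: no.
    exists (u, east); last by case: Eu => _ E; apply: ord_inj.
    have E : mv (gv u) east = (i.+1%:Z, (k : nat)%:Z) by rewrite Eu mvE /=; congr pair; lia.
    rewrite inE bdryE inz_gv uK E nk /box /= andbT.
    by have := ltn_ord k; lia.
  have all_in (j : nat) : (a + j < n)%N -> inz K ((a + j)%N%:Z, (k : nat)%:Z).
    elim: j => [|j IH] hj; first by rewrite addn0; exact: col.
    rewrite addnS in hj *; apply: step => //; exact/IH/ltnW.
  have /inzP[u uK []] := all_in (n.-1 - a)%N ltac:(lia).
  move=> E1 _; have := mK u uK; rewrite E1; move: an; clear; lia.
pose f (k : 'I_n) := s2val (cid2 (ex k)).
have fP (k : 'I_n) : f k \in bd K /\ (f k).1.2 = k.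
  by rewrite /f; case: cid2.
rewrite -[leqLHS]card_ord -cardsT -(card_imset _ (f := f)); last first.
  by move=> k k' E; rewrite -(fP k).2 E (fP k').2.
by apply/subset_leq_card/subsetP => e /imsetP[k _ ->]; case: (fP k).
Qed.

Lemma conn_columns C u v (k : nat) : conn C -> u \in C -> v \in C -> (u.1 <= k <= v.1)%N ->
  exists2 w, w \in C & w.1 = k :> nat.
Proof.
move=> cC uC vC /andP[uk kv]; apply: contrapT => no.
have ne w : w \in C -> w.1 != k :> nat.
  by move=> wC; apply/eqP => E; apply: no; exists w.
have : (v.1 < k)%N.
  apply: (connect_ind (P := fun w => (w.1 < k)%N)) (cC _ _ uC vC) _ => [x y /and3P[/adj_col[h _] xC yC] xk|].
    by rewrite ltn_neqAle ne //; apply: leq_trans h xk.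
  by rewrite ltn_neqAle ne.
by rewrite ltnNge kv.
Qed.

(** If [K] contains a full column, every row has a horizontal boundary edge. If not, each of [m + 1]
    columns met by [C] has a vertical one. *)
Lemma spread_length C K u v m : misses_right K -> C \subset K -> conn C -> u \in C -> v \in C ->
  (m < n)%N -> (u.1 + m <= v.1)%N -> (m < #|bd K|)%N.
Proof.
move=> mK CK cC uC vC mn uv.
case: (pselect (exists2 a : nat, (a < n)%N & forall k : nat, (k < n)%N -> inz K (a%:Z, k%:Z))).
  by case=> a an h; apply: leq_trans mn (full_column_length mK an h).
move=> nofull.
have ex (i : 'I_m.+1) : exists2 f, f \in bd K & f.1.1 = (u.1 + i)%N :> nat.
  apply: contrapT => no; apply: nofull.
  have hi : (u.1 <= u.1 + i <= v.1)%N by have := ltn_ord i; lia.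
  have [w wC wi] := conn_columns cC uC vC hi.
  exists (u.1 + i)%N; first by rewrite -wi.
  have step (k : nat) : (k.+1 < n)%N ->
      inz K ((u.1 + i)%N%:Z, k%:Z) = inz K ((u.1 + i)%N%:Z, k.+1%:Z).
    move=> hk; apply/idP/idP => /inzP[p pK Ep]; apply: contraT => nk; exfalso; apply: no.
      exists (p, (true, false)); last by case: Ep.
      have E : mv (gv p) (true, false) = ((u.1 + i)%N%:Z, k.+1%:Z) by rewrite Ep mvE /=; congr pair; lia.
      by rewrite inE bdryE inz_gv pK E nk /box /= andbT -wi; have := ltn_ord w.1; lia.
    exists (p, (true, true)); last by case: Ep.
    have E : mv (gv p) (true, true) = ((u.1 + i)%N%:Z, k%:Z) by rewrite Ep mvE /=; congr pair; lia.
    by rewrite inE bdryE inz_gv pK E nk /box /= andbT -wi; have := ltn_ord w.1; lia.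
  have c := nat_const step.
  have h0 : inz K ((u.1 + i)%N%:Z, (w.2 : nat)%:Z).
    rewrite (_ : (_, _) = gv w) ?inz_gv ?(subsetP CK) //.
    by rewrite /grid_vertex wi.
  by move=> k hk; rewrite (c k hk) -(c w.2 (ltn_ord _)).
pose f (k : 'I_m.+1) := s2val (cid2 (ex k)).
have fP (k : 'I_m.+1) : f k \in bd K /\ (f k).1.1 = (u.1 + k)%N :> nat.
  by rewrite /f; case: cid2.
rewrite -[leqLHS]card_ord -cardsT -(card_imset _ (f := f)); last first.
  move=> k k' E; apply: ord_inj; have h1 := (fP k).2; have h2 := (fP k').2.
  by rewrite E h2 in h1; lia.
by apply/subset_leq_card/subsetP => e /imsetP[k _ ->]; case: (fP k).
Qed.


(* Nontrivial components are the closures [W U N(W)] of the distance-two clusters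
   [W] of occupied cells of parity [b]. *)
Definition clus (b : bool) J : rel G := fun u v => grid_adj u v &&
  ((u \in J) && (par (gv u) == b) || (v \in J) && (par (gv v) == b)).

Definition spans b J : bool :=
  [exists u : G, [exists v : G, [&& u.1 == 0%N :> nat, v.1.+1 == n & connect (clus b J) u v]]].

Lemma spansP b J : reflect (exists u v : G, [/\ u.1 = 0%N :> nat, v.1.+1 = n & connect (clus b J) u v])
  (spans b J).
Proof.
apply: (iffP existsP) => [[u /existsP[v /and3P[/eqP h1 /eqP h2 h3]]]|[u [v [h1 h2 h3]]]].
  by exists u, v.
by exists u; apply/existsP; exists v; rewrite h1 h2 h3 !eqxx.
Qed.

Lemma clus_sym b J : symmetric (clus b J).
Proof. by move=> u v; rewrite /clus adj_sym_grid orbC. Qed.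

Lemma clus_connect_sym b J : connect_sym (clus b J).
Proof. exact: (sym_connect_sym (@clus_sym b J)). Qed.

Lemma adj_par u v : grid_adj u v -> par (gv v) = ~~ par (gv u).
Proof. by case/adjP => d ->; rewrite par_mv. Qed.

(* Clusters of parity [b] cannot cross a contour whose inner side has parity [~~ b]. *)
Lemma spans_shift b J K S : typed b K -> compat J K -> misses_right K -> S \subset exits K ->
  spans b (shift K J S) -> spans b J.
Proof.
move=> tK cJ mK SF /spansP[u [v [u0 vn huv]]]; apply/spansP; exists u, v; split=> //.
rewrite clus_connect_sym in huv; rewrite clus_connect_sym.
have vK : v \notin K by apply/negP => /mK; rewrite vn ltnn.
suff : u \notin K /\ connect (clus b J) v u by case.
apply: (connect_ind (P := fun u => u \notin K /\ connect (clus b J) v u)) huv _ => [x y|];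
  last by split=> //; exact: connect0.
move=> /andP[xy h] [xK cx].
have yx : grid_adj y x by rewrite adj_sym_grid.
have yK : y \notin K.
  apply/negP => yK; move: h; rewrite (shift_outside cJ SF xK).
  have /andP[_ /negbTE ->] := proj1 (compatP J K) cJ y x yx yK xK.
  by rewrite (proj1 (typedP b K) tK y x yx yK xK) /=; case: (b); rewrite andbF.
split=> //; apply: connect_trans cx (connect1 _); rewrite /clus xy /=.
by move: h; rewrite !(shift_outside cJ SF).
Qed.

Section Component.
Variables (b : bool) (J : {set G}) (x0 : G).
Hypothesis iJ : independent (@grid_adj n) J.
Definition cluster : {set G} := [set v | connect (clus b J) x0 v].

Lemma cluster0 : x0 \in cluster. Proof. by rewrite inE connect0. Qed.

Lemma cluster_step x y : x \in cluster -> clus b J x y -> y \in cluster.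
Proof. by rewrite !inE => /connect_trans h /connect1 /h. Qed.

Lemma conn_cluster : conn cluster.
Proof.
have h v : v \in cluster -> connect (gin cluster) x0 v.
  rewrite inE => c; suff : v \in cluster /\ connect (gin cluster) x0 v by case.
  apply: (connect_ind (P := fun v => v \in cluster /\ connect (gin cluster) x0 v)) c _ => [x y xy [xE cx]|].
    have yE := cluster_step xE xy; split=> //.
    by apply: connect_trans cx (connect1 _); case/andP: xy => xy _; rewrite /gin xy xE yE.
  by split; [exact: cluster0 | exact: connect0].
move=> u v uE vE; apply: connect_trans (h v vE).
by rewrite (sym_connect_sym (gin_sym _)); exact: h.
Qed.

Lemma cluster_nbr x y : y \in cluster -> y != x0 -> x \in cluster -> exists z : G, clus b J x z.
Proof.
move=> yC yx xC.
have /connectP[p] : connect (clus b J) x (if x == x0 then y else x0).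
  case: eqP => [->|_]; first by move: yC; rewrite inE.
  by rewrite clus_connect_sym; move: xC; rewrite inE.
case: p => [_ /= E|z p /= /andP[h _] _]; last by exists z.
by move: E; case: eqP => [xx0 E|h /esym //]; rewrite E xx0 eqxx in yx.
Qed.

(** The cell [y] makes the cluster nontrivial, so [u] is linked to some [z]. As [u] and [v] are not
    linked, it is [z] that is occupied with parity [b]; hence [u] has the other parity and is vacant
    by independence, while [v] has parity [b] and must be vacant. *)
Lemma cluster_boundary y u v : y \in cluster -> y != x0 -> grid_adj u v -> u \in cluster -> v \notin cluster ->
  [/\ par (gv u) = ~~ b, u \notin J & v \notin J].
Proof.
move=> yC yx uv uC vC.
have nc : ~~ clus b J u v by apply: contra vC; exact: cluster_step.
move: nc; rewrite /clus uv negb_or => /andP[nu nv].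
have [z /andP[uz hz]] := cluster_nbr yC yx uC.
have {}hz : (z \in J) && (par (gv z) == b) by move: hz; rewrite (negbTE nu).
case/andP: hz => zJ /eqP pz.
have pu : par (gv u) = ~~ b by rewrite -pz (adj_par uz) negbK.
have pv : par (gv v) = b by rewrite (adj_par uv) pu negbK.
split=> //; last by move: nv; rewrite pv eqxx andbT.
apply/negP => uJ; have /forall_inP/(_ u uJ)/forall_inP/(_ z zJ) := iJ.
by rewrite uz.
Qed.

Lemma cluster_typed y : y \in cluster -> y != x0 -> typed b cluster.
Proof. by move=> yC yx; apply/typedP => u v uv uC vC; case: (cluster_boundary yC yx uv uC vC). Qed.

Lemma cluster_compat y : y \in cluster -> y != x0 -> compat J cluster.
Proof.
by move=> yC yx; apply/compatP => u v uv uC vC; case: (cluster_boundary yC yx uv uC vC) => _ -> ->.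
Qed.

End Component.

Lemma faulty_of_spread b J C u v m : (1 < n)%N -> (0 < m < n)%N -> conn C -> typed b C -> compat J C ->
  misses_right C -> u \in C -> v \in C -> (u.1 + m <= v.1)%N -> faulty b m J.
Proof.
move=> n2 /andP[m0 mn] cC tC jC mC uC vC uv.
have c1 : (1 < #|C|)%N.
  apply/card_gt1P; exists u, v; split=> //; apply/eqP => E; move: uv; rewrite E.
  by rewrite -[leqRHS]addn0 leq_add2l leqNgt m0.
have [K [csK mK cK CK]] := contour_of n2 cC c1 tC jC mC.
apply/asboolP; exists K; split=> //.
exact: (spread_length mK CK cC uC vC mn uv).
Qed.

(** * Reflection exchanging the left and right sides *)

Definition reflect_cell u : G := (rev_ord u.1, u.2).
Local Notation rf := reflect_cell.

Lemma rfK : involutive rf.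
Proof. by case=> x y; rewrite /rf /= rev_ordK. Qed.
Lemma rf_inj : injective rf. Proof. exact: inv_inj rfK. Qed.

Lemma rf_adj u v : grid_adj (rf u) (rf v) = grid_adj u v.
Proof.
case: u v => [[a ha] c] [[a' ha'] c']; rewrite /grid_adj /Z2_adj /=.
congr (_ + _ == _)%N; lia.
Qed.

Lemma mem_rf C u : (rf u \in rf @: C) = (u \in C).
Proof. by rewrite mem_imset //; exact: rf_inj. Qed.

Lemma mem_rf' C u : (u \in rf @: C) = (rf u \in C).
Proof. by rewrite -{1}(rfK u) mem_rf. Qed.

Lemma rf_imK : involutive (fun C => rf @: C).
Proof. by move=> C; apply/setP => u; rewrite !mem_rf' rfK. Qed.

Let flipb b := b (+) odd n.-1.

Lemma rf_par u : par (gv (rf u)) = flipb (par (gv u)).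
Proof. by case: u => [[a ha] [c hc]]; rewrite /par /flipb /=; lia. Qed.

Lemma rf_independent J : independent (@grid_adj n) J -> independent (@grid_adj n) (rf @: J).
Proof.
move=> /forall_inP h; apply/forall_inP => u; rewrite mem_rf' => uJ.
apply/forall_inP => v; rewrite mem_rf' => vJ.
by rewrite -(rfK u) -(rfK v) rf_adj; have /forall_inP := h _ uJ; apply.
Qed.

Lemma rf_clus b J u v : clus (flipb b) (rf @: J) (rf u) (rf v) = clus b J u v.
Proof.
rewrite /clus rf_adj !mem_rf !rf_par; have F c : (flipb c == flipb b) = (c == b).
  by rewrite /flipb; case: c; case: (b); case: odd.
by rewrite !F.
Qed.

Lemma connect_map (T T' : finType) (e : rel T) (e' : rel T') (f : T -> T') :
  (forall a c, e a c -> e' (f a) (f c)) -> forall a c, connect e a c -> connect e' (f a) (f c).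
Proof.
move=> h a c hc; apply: (connect_ind (P := fun c => connect e' (f a) (f c))) hc (connect0 _ _).
by move=> p q /h/connect1 hpq /connect_trans; exact.
Qed.

Lemma rf_spans b J : spans b J -> spans (flipb b) (rf @: J).
Proof.
case/spansP => u [v [u0 vn c]]; apply/spansP; exists (rf v), (rf u); split.
- by case: v vn {c} => [[a ha] c] /= vn; lia.
- by case: u u0 {c} => [[a ha] c] /= u0; lia.
rewrite clus_connect_sym; apply: connect_map c => a c.
by rewrite rf_clus.
Qed.

Lemma flipbK b : flipb (flipb b) = b.
Proof. by rewrite /flipb -addbA addbb addbF. Qed.

Lemma rf_spansE b J : spans (flipb b) (rf @: J) = spans b J.
Proof.
by apply/idP/idP => [/rf_spans|/rf_spans //]; rewrite flipbK rf_imK.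
Qed.

Lemma faulty_of_spread_left b J C u v m : (1 < n)%N -> (0 < m < n)%N -> conn C -> typed b C ->
  compat J C -> (forall w, w \in C -> (0 < w.1)%N) -> u \in C -> v \in C -> (u.1 + m <= v.1)%N ->
  faulty (flipb b) m (rf @: J).
Proof.
move=> n2 mn cC tC jC mC uC vC uv.
apply: (@faulty_of_spread _ _ (rf @: C) (rf v) (rf u)) => //.
- move=> x y; rewrite !mem_rf' => xC yC; rewrite -(rfK x) -(rfK y).
  apply: connect_map (cC _ _ xC yC) => p q /and3P[pq pC qC].
  by rewrite /gin rf_adj pq !mem_rf pC qC.
- apply/typedP => x y; rewrite -(rfK x) -(rfK y) rf_adj !mem_rf rf_par => xy xC yC.
  by rewrite (proj1 (typedP _ _) tC _ _ xy xC yC) /flipb; case: (b); case: odd.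
- apply/compatP => x y; rewrite -(rfK x) -(rfK y) rf_adj !mem_rf => xy xC yC.
  exact: (proj1 (compatP _ _) jC _ _ xy xC yC).
- by move=> w; rewrite mem_rf' => /mC; case: w => [[a ha] c] /=; lia.
- by rewrite mem_rf.
- by rewrite mem_rf.
- by case: u v {uC vC} uv => [[a ha] c] [[a' ha'] c'] /=; lia.
Qed.

Definition faulty2 b m J := faulty b m J || faulty (flipb b) m (rf @: J).

(** A cluster that does not span misses the right side or the left side; in the latter case the
    reflected configuration has the fault. *)
Lemma faulty2_of_spread b J u v m : (1 < n)%N -> (0 < m < n)%N ->
  independent (@grid_adj n) J -> ~~ spans b J ->
  connect (clus b J) u v -> (u.1 + m <= v.1)%N -> faulty2 b m J.
Proof.
move=> n2 mn iJ nsp cuv uv.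
have uC : u \in cluster b J u by exact: cluster0.
have vC : v \in cluster b J u by rewrite inE.
have vu : v != u.
  apply/eqP => E; case/andP: mn => m0 _; move: uv.
  by rewrite E -[leqRHS]addn0 leq_add2l leqNgt m0.
have tC := cluster_typed iJ vC vu; have jC := cluster_compat iJ vC vu.
have cC := @conn_cluster b J u.
rewrite /faulty2; case: (pselect (misses_right (cluster b J u))) => mC.
  by rewrite (faulty_of_spread n2 mn cC tC jC mC uC vC uv).
rewrite (@faulty_of_spread_left b J (cluster b J u) u v) ?orbT // => w wC.
rewrite lt0n; apply/negP => /eqP w0; apply: mC => w' w'C; rewrite ltn_neqAle ltn_ord andbT.
apply/negP => /eqP w'n; move/negP: nsp; apply; apply/spansP; exists w, w'; split=> //.
rewrite inE in wC; rewrite inE in w'C.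
by apply: connect_trans w'C; rewrite clus_connect_sym.
Qed.

(** Links not involving [p] are present without it, so a path can leave the cluster of [u] only next
    to [p] or at [p]. *)
Lemma cluster_near_pivot b J p u w : connect (clus b (p |: J)) u w -> w \notin cluster b J u ->
  exists2 x : G, x \in cluster b J u & (x.1 <= p.1.+1)%N && (p.1 <= x.1.+1)%N.
Proof.
move=> c wC; apply: contrapT => no; move/negP: wC; apply.
apply: (connect_ind (P := fun x => x \in cluster b J u)) c (cluster0 b J u) => x y /andP[xy h] xC.
apply: (cluster_step xC); rewrite /clus xy /=.
have xp : x != p.
  by apply/eqP => E; apply: no; exists x; rewrite // E !leqnSn.
have yp : y != p.
  by apply/eqP => E; apply: no; exists x; rewrite // -E; have [-> ->] := adj_col xy.
by move: h; rewrite !in_setU1 (negbTE xp) (negbTE yp).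
Qed.

(** Without [p] there remain a cluster from the left side to near [p] and one from the right side to
    near [p]. As [2 * m + 2 <= n], one of them extends over [m] columns. *)
Lemma pivot_faulty b J p m : (0 < m)%N -> (2 * m + 2 <= n)%N -> independent (@grid_adj n) J ->
  ~~ spans b J -> spans b (p |: J) -> faulty2 b m J.
Proof.
move=> m0 mn iJ nsp /spansP[u [w [u0 wn c]]].
have n2 : (1 < n)%N by move: m0 mn; clear; lia.
have mn' : (0 < m < n)%N by move: m0 mn; clear; lia.
have nuw : ~ connect (clus b J) u w by move=> h; move/negP: nsp; apply; apply/spansP; exists u, w.
have wC : w \notin cluster b J u by rewrite inE; exact/negP.
have uC : u \notin cluster b J w by rewrite inE clus_connect_sym; exact/negP.
case: (ltnP m p.1) => pm.
  have [x xC /andP[_ xp]] := cluster_near_pivot c wC.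
  apply: (faulty2_of_spread (u := u) (v := x)) => //; first by rewrite inE in xC.
  by rewrite u0; move: pm xp; clear; lia.
rewrite clus_connect_sym in c.
have [x xC /andP[xp _]] := cluster_near_pivot c uC.
apply: (faulty2_of_spread (u := x) (v := w)) => //; first by rewrite clus_connect_sym; rewrite inE in xC.
by move: pm xp wn mn; clear; lia.
Qed.

(** * Configurations with no spanning cluster *)

Section NoSpan.
Variables (J : {set G}) (m : nat).
Hypothesis m_gt0 : (0 < m)%N.
Hypothesis m_lt : (2 * m + 2 <= n)%N.
Hypothesis iJ : independent (@grid_adj n) J.
Hypothesis short : forall b (u v : G), connect (clus b J) u v -> (v.1 < u.1 + m)%N.

(* Sets closed under [reach] have all their inner boundary cells vacant and odd,
   all their outer boundary cells vacant. *)
Definition reach : rel G := fun u v =>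
  grid_adj u v && [|| ~~ par (gv u), u \in J | v \in J].

Definition left_reach : {set G} :=
  [set v | [exists u : G, (u.1 == 0%N :> nat) && connect reach u v]].

Lemma left_reachP v : reflect (exists2 u : G, u.1 = 0%N :> nat & connect reach u v) (v \in left_reach).
Proof.
rewrite inE; apply: (iffP existsP) => [[u /andP[/eqP h c]]|[u h c]]; exists u => //.
by rewrite h eqxx.
Qed.

Lemma left_reach_step u v : u \in left_reach -> reach u v -> v \in left_reach.
Proof.
move=> /left_reachP[w w0 c] h; apply/left_reachP; exists w => //.
exact: connect_trans c (connect1 h).
Qed.

Lemma left_reach_left v : v.1 = 0%N :> nat -> v \in left_reach.
Proof. by move=> v0; apply/left_reachP; exists v. Qed.

Let from_left v := exists2 u : G, u.1 = 0%N :> nat & connect (clus true J) u v.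
Let from_near v := (if par (gv v) then v \notin J else v \in J) /\
  exists2 u : G, (u.1 <= m)%N & connect (clus false J) u v.

(** A path of [reach] first follows an odd cluster from the left side. When it steps off that
    cluster, it does so to a vacant odd or an occupied even cell, and from then on it meets only
    such cells, linked by even clusters. Both phases are short. *)
Lemma left_reach_origin v : v \in left_reach -> from_left v \/ from_near v.
Proof.
case/left_reachP => w w0 c.
apply: (connect_ind (P := fun v => from_left v \/ from_near v)) c _; last first.
  by left; exists w => //; exact: connect0.
have vac p q : grid_adj p q -> p \in J -> q \notin J.
  move=> pq pJ; apply/negP => qJ; have /forall_inP/(_ p pJ)/forall_inP/(_ q qJ) := iJ.
  by rewrite pq.
move=> x y /andP[xy h] [[u u0 c]|[hx [u um c]]].
  have xm : (x.1 < m)%N by have := short c; rewrite u0.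
  have ym : (y.1 <= m)%N by have [yx _] := adj_col xy; apply: leq_trans yx xm.
  have odd_step : clus true J x y -> from_left y.
    by move=> cxy; exists u => //; exact: connect_trans c (connect1 cxy).
  case: (boolP (par (gv x))) h => px /=.
    case: (boolP (x \in J)) => xJ /= yJ.
      by left; apply: odd_step; rewrite /clus xy xJ px.
    right; split; first by rewrite (adj_par xy) px.
    exists x; first exact: ltnW.
    by apply: connect1; rewrite /clus xy yJ (adj_par xy) px orbT.
  move=> _; have py : par (gv y) by rewrite (adj_par xy).
  case: (boolP (y \in J)) => yJ.
    by left; apply: odd_step; rewrite /clus xy yJ py orbT.
  by right; split; [rewrite py | exists y => //; exact: connect0].
right; have py := adj_par xy.
case: (boolP (par (gv x))) h hx py => px /= h hx py.
  rewrite (negbTE hx) /= in h; split; first by rewrite py.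
  exists u => //; apply: connect_trans c (connect1 _).
  by rewrite /clus xy h py orbT.
split; first by rewrite py (vac x y).
exists u => //; apply: connect_trans c (connect1 _).
by rewrite /clus xy hx (negbTE px).
Qed.

Lemma left_reach_cols v : v \in left_reach -> (v.1 < 2 * m)%N.
Proof.
move/left_reach_origin => [[u u0 /short]|[_ [u um /short]]]; first by rewrite u0; move: m_gt0; clear; lia.
by move: um; clear; lia.
Qed.

Lemma left_column_connect u v : u.1 = 0%N :> nat -> v.1 = 0%N :> nat ->
  connect (gin left_reach) u v.
Proof.
have sym := sym_connect_sym (gin_sym left_reach).
have n0 : (0 < n)%N by move: m_lt; clear; lia.
pose o (k : nat) (hk : (k < n)%N) : G := (Ordinal n0, Ordinal hk).
have base k (hk : (k < n)%N) : connect (gin left_reach) (o 0%N n0) (o k hk).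
  elim: k hk => [|k IH] hk; first by rewrite (bool_irrelevance hk n0).
  apply: connect_trans (IH (ltnW hk)) (connect1 _).
  rewrite /gin !left_reach_left // !andbT.
  by apply/adjP; exists (true, false); rewrite mvE /grid_vertex /=; congr pair; lia.
have E v' : v'.1 = 0%N :> nat -> exists k (hk : (k < n)%N), v' = o k hk.
  case: v' => [a [k hk]] /= a0; exists k, hk; congr pair; exact: ord_inj.
move=> /E[k [hk ->]] /E[l [hl ->]]; apply: connect_trans (base l hl).
by rewrite sym.
Qed.

(** [left_reach] contains the left side and stays within the first [2 * m] columns, so filling its
    holes gives a set with a boundary edge in every row. *)
Lemma faulty_left_reach : faulty false m J.
Proof.
have n2 : (1 < n)%N by move: m_lt; clear; lia.
have n0 : (0 < n)%N by exact: ltnW.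
have h u v : u.1 = 0%N :> nat -> connect reach u v -> connect (gin left_reach) u v.
  move=> u0 c; suff : v \in left_reach /\ connect (gin left_reach) u v by case.
  apply: (connect_ind (P := fun v => v \in left_reach /\ connect (gin left_reach) u v)) c _ => [x y xy [xE cx]|].
    have yE := left_reach_step xE xy; split=> //.
    by apply: connect_trans cx (connect1 _); case/andP: xy => xy _; rewrite /gin xy xE yE.
  by split; [exact: left_reach_left | exact: connect0].
have cC : conn left_reach.
  move=> u v /left_reachP[u' u0 cu] /left_reachP[v' v0 cv].
  apply: connect_trans (h _ _ v0 cv); apply: connect_trans (left_column_connect u0 v0).
  by rewrite (sym_connect_sym (gin_sym _)); exact: h.
have bdr u v : grid_adj u v -> u \in left_reach -> v \notin left_reach ->
    [/\ par (gv u), u \notin J & v \notin J].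
  move=> uv uC vC; have : ~~ reach u v by apply: contra vC; exact: left_reach_step.
  by rewrite /reach uv /= !negb_or negbK => /and3P.
have tC : typed false left_reach by apply/typedP => u v uv uC vC; case: (bdr u v uv uC vC).
have jC : compat J left_reach.
  by apply/compatP => u v uv uC vC; case: (bdr u v uv uC vC) => _ -> ->.
have mC : misses_right left_reach by move=> u /left_reach_cols; move: m_lt; clear; lia.
have c1 : (1 < #|left_reach|)%N.
  apply/card_gt1P; exists (Ordinal n0, Ordinal n0), (Ordinal n0, Ordinal n2).
  by split; rewrite ?left_reach_left //; apply/eqP => -[].
have [K [csK mK cK CK]] := contour_of n2 cC c1 tC jC mC.
apply/asboolP; exists K; split=> //.
have mn : (m < n)%N by move: m_lt; clear; lia.
apply: leq_trans mn (full_column_length (a := 0%N) mK n0 _) => k hk.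
rewrite (_ : (_, _) = gv (Ordinal n0, Ordinal hk)) // inz_gv (subsetP CK) //.
exact: left_reach_left.
Qed.

End NoSpan.

Lemma no_span_faulty J m : (0 < m)%N -> (2 * m + 2 <= n)%N -> independent (@grid_adj n) J ->
  ~~ spans true J -> ~~ spans false J -> exists b, faulty2 b m J.
Proof.
move=> m0 mn iJ s1 s2.
have n2 : (1 < n)%N by move: m0 mn; clear; lia.
have mn' : (0 < m < n)%N by move: m0 mn; clear; lia.
case: (pselect (exists b (u v : G), connect (clus b J) u v /\ (u.1 + m <= v.1)%N)).
  move=> [b [u [v [c uv]]]]; exists b; apply: faulty2_of_spread c uv => //.
  by case: b.
move=> no; exists false; rewrite /faulty2 faulty_left_reach // => b u v c.
by rewrite ltnNge; apply/negP => uv; apply: no; exists b, u, v.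
Qed.

End Existence.

(** * Conductance *)

Section Conductance.
Variables (R : realType) (lambda theta M rho B : R) (n : nat).
Hypothesis lambda_gt0 : 0 < lambda.
Hypothesis theta_ge1 : 1 <= theta.
Hypothesis theta2 : theta ^+ 2 = theta + lambda.
Hypothesis M_ge1 : 1 <= M.
Hypothesis rho_gt0 : 0 < rho.
Hypothesis rho_le1 : rho <= 1.
Hypothesis M2 : M ^+ 2 * theta <= rho ^+ 2 * (1 + lambda).
Hypothesis M4 : M ^+ 4 <= rho ^+ 4 * (1 + lambda).
Hypothesis B_gt0 : 0 < B.
Hypothesis growth : forall m, (taxi_count m)%:R <= B * M ^+ m.
Local Notation G := (grid n).
Local Notation gv := (@grid_vertex n).
Local Notation T := (indset (@grid_adj n)).
Local Notation rf := (@reflect_cell n).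
Local Notation weight Q := (\sum_(I : T | Q I) lambda ^+ #|val I|).
Implicit Types (I : T) (Q : pred T) (b : bool).

Definition reflect_indset I : T := Sub (rf @: val I) (rf_independent (indset_independent I)).

Lemma val_reflect I : val (reflect_indset I) = rf @: val I. Proof. by []. Qed.

Lemma reflect_indsetK : involutive reflect_indset.
Proof. by move=> I; apply: val_inj; rewrite !val_reflect rf_imK. Qed.

Lemma weight_reflect Q : weight (fun I => Q (reflect_indset I)) = weight Q.
Proof.
rewrite [RHS](reindex_inj (inv_inj reflect_indsetK)) /=; apply: eq_bigr => I _.
by rewrite card_imset //; exact: rf_inj.
Qed.

Let c (m : nat) := 16 * n%:R ^+ 4 * B * theta ^+ 2 * rho ^+ m.

Lemma faulty2_weight b m Q :
  (forall (K : {set G}) I I' (S : {set G}), long_contour b m (val I) K -> Q I -> S \subset exits K ->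
     val I' = shift K (val I) S -> Q I') ->
  (forall (K : {set G}) I I' (S : {set G}), long_contour (b (+) odd n.-1) m (val I) K -> Q (reflect_indset I) ->
     S \subset exits K -> val I' = shift K (val I) S -> Q (reflect_indset I')) ->
  weight (fun I => Q I && faulty2 b m (val I)) <= 2 * c m * weight Q.
Proof.
move=> h1 h2.
have p1 := peierls lambda_gt0 theta_ge1 theta2 M_ge1 rho_gt0 rho_le1 M2 M4 B_gt0 growth
  (@conn_grid n) h1.
have p2 := peierls (Q := fun I => Q (reflect_indset I))
  lambda_gt0 theta_ge1 theta2 M_ge1 rho_gt0 rho_le1 M2 M4 B_gt0 growth (@conn_grid n) h2.
rewrite weight_reflect in p2.
rewrite -(weight_reflect (fun I => Q (reflect_indset I) && _)) in p2.
rewrite -[2]/(1 + 1) mulrDl mulrDl mul1r.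
apply: le_trans (lerD p1 p2).
rewrite big_mkcond [X in _ <= X + _]big_mkcond [X in _ <= _ + X]big_mkcond -big_split /=.
apply: ler_sum => I _; rewrite reflect_indsetK /faulty2.
have w0 : 0 <= lambda ^+ #|val I| by rewrite exprn_ge0 // ltW.
case: (Q I) => //=; last by rewrite addr0.
rewrite -/(rf @: val I).
case: (faulty b m (val I)) => /=; case: (faulty _ m _); rewrite ?addr0 ?add0r //.
by rewrite lerDl.
Qed.

Lemma not_spans_shift b m (K : {set G}) I I' (S : {set G}) : long_contour b m (val I) K -> ~~ spans b (val I) ->
  S \subset exits K -> val I' = shift K (val I) S -> ~~ spans b (val I').
Proof.
move=> [[tK _ _ _ _] mK cK _] nsp SF ->; apply: contra nsp.
exact: spans_shift.
Qed.

Lemma spans_reflect b I : spans b (val (reflect_indset I)) = spans (b (+) odd n.-1) (val I).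
Proof.
by have := rf_spansE (b (+) odd n.-1) (val I); rewrite -addbA addbb addbF.
Qed.

Lemma near_spanning_weight b m :
  weight (fun I => ~~ spans b (val I) && faulty2 b m (val I)) <=
  2 * c m * weight (fun I => ~~ spans b (val I)).
Proof.
apply: faulty2_weight => K I I' S lc; first exact: not_spans_shift lc.
by rewrite !spans_reflect; exact: not_spans_shift lc.
Qed.

Lemma nonspanning_weight m : (0 < m)%N -> (2 * m + 2 <= n)%N ->
  weight (fun I => ~~ (spans true (val I) || spans false (val I))) <= 4 * c m * weight predT.
Proof.
move=> m0 mn.
have h b : weight (fun I => faulty2 b m (val I)) <= 2 * c m * weight predT.
  exact: (@faulty2_weight b m predT).
have E : 4 * c m = 2 * c m + 2 * c m by rewrite -mulrDl; congr (_ * _); lra.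
rewrite E mulrDl; apply: le_trans (lerD (h true) (h false)).
rewrite big_mkcond [X in _ <= X + _]big_mkcond [X in _ <= _ + X]big_mkcond -big_split /=.
apply: ler_sum => I _.
have w0 : 0 <= lambda ^+ #|val I| by rewrite exprn_ge0 // ltW.
case: ifP => [|_]; last by apply: addr_ge0; case: ifP.
rewrite negb_or => /andP[s1 s2].
have [b fb] := no_span_faulty m0 mn (indset_independent I) s1 s2.
by case: b fb => ->; rewrite ?lerDl ?lerDr; case: ifP.
Qed.

Lemma spans_mono b (J J' : {set G}) : J \subset J' -> spans b J -> spans b J'.
Proof.
move=> /subsetP JJ' /spansP[u [v [u0 vn h]]]; apply/spansP; exists u, v; split=> //.
apply: connect_sub h => x y /andP[xy h]; apply: connect1; rewrite /clus xy /=.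
by case/orP: h => /andP[/JJ' -> ->]; rewrite ?orbT.
Qed.

Local Notation P := (glauber (e := @grid_adj n) lambda).
Local Notation pi := (gibbs (e := @grid_adj n) lambda).
Definition spanning b : {set T} := [set I : T | spans b (val I)].

(** By monotonicity a move into the spanning set adds a cell rather than removes one, and that cell
    is pivotal. *)
Lemma outer_spanning b m I : (0 < m)%N -> (2 * m + 2 <= n)%N -> I \in outer P (spanning b) ->
  ~~ spans b (val I) && faulty2 b m (val I).
Proof.
move=> m0 mn; rewrite inE => /andP[]; rewrite inE => nsp /existsP[I' /andP[]].
rewrite inE => sp; rewrite nsp /=.
have ne : I != I' by apply/eqP => E; rewrite -E (negbTE nsp) in sp.
move/(glauber_neq0 ne)/cards1P => [p hp].
have E : val I' = symdiff (val I) [set p] by rewrite -hp symdiffK.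
have [pI|pI] := boolP (p \in val I).
  exfalso; move/negP: nsp; apply; apply: spans_mono sp; rewrite E.
  by apply/subsetP => x; rewrite !inE => /orP[/andP[]//|/andP[_ /eqP -> //]].
have E2 : val I' = p |: val I.
  rewrite E; apply/setP => x; rewrite !inE; case: eqP => [->|_]; first by rewrite (negbTE pI).
  by rewrite andbF orbF.
by apply: (pivot_faulty m0 mn (indset_independent I) nsp (p := p)); rewrite -E2.
Qed.

Lemma pi_weight (A : {set T}) :
  \sum_(I in A) pi I = weight (fun I => I \in A) / partition_function (@grid_adj n) lambda.
Proof. by rewrite mulr_suml. Qed.

Lemma partition_weight : partition_function (@grid_adj n) lambda = weight predT.
Proof. by []. Qed.

Lemma mixing_lower_bound m t : (0 < m)%N -> (2 * m + 2 <= n)%N -> (0 < t)%N ->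
  worst_tv P pi t <= 1 / 4 -> 1 <= t%:R * (32 * c m).
Proof.
move=> m0 mn t0 hw.
have n2 : (1 < n)%N by move: mn; clear; lia.
have Z0 := partition_function_gt0 (@grid_adj n) lambda_gt0.
have t1 : 1 <= t%:R :> R by rewrite ler1n.
have th0 : 0 < theta by apply: lt_le_trans theta_ge1.
have c0 : 0 <= c m by rewrite /c !mulr_ge0 ?exprn_ge0 ?(ltW B_gt0) ?(ltW th0) ?(ltW rho_gt0).
(* If [8 * c m > 1] the claim is immediate from [t >= 1]. Otherwise the configurations spanning in
   neither parity have probability at most [4 * c m <= 1/2]. *)
case: (leP (8 * c m) 1) => hc; last first.
  have : 1 * (32 * c m) <= t%:R * (32 * c m) by rewrite ler_wpM2r // mulr_ge0.
  lra.
have nsp0 b : empty_indset (@grid_adj n) \in ~: spanning b.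
  rewrite !inE; apply/negP => /spansP[u [v [u0 vn h]]].
  suff E : v = u by move: vn; rewrite E u0; move: n2; clear; lia.
  apply: (connect_ind (P := fun v => v = u)) h erefl => x y /andP[_].
  by rewrite /= !inE.
have pos b : 0 < \sum_(I in ~: spanning b) pi I.
  rewrite (bigD1 (empty_indset (@grid_adj n))) //= ltr_pwDl ?gibbs_gt0 //.
  by apply: sumr_ge0 => I _; rewrite ltW // gibbs_gt0.
have out b : \sum_(I in outer P (spanning b)) pi I <= 2 * c m * \sum_(I in ~: spanning b) pi I.
  rewrite !pi_weight mulrA ler_pM2r ?invr_gt0 //.
  have -> : weight (fun I => I \in ~: spanning b) = weight (fun I => ~~ spans b (val I)).
    by apply: eq_bigl => I; rewrite !inE.
  apply: le_trans (near_spanning_weight b m).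
  rewrite big_mkcond [leRHS]big_mkcond /=; apply: ler_sum => I _.
  have w0 : 0 <= lambda ^+ #|val I| by rewrite exprn_ge0 // ltW.
  case: ifP => [/(outer_spanning m0 mn) ->//|_]; by case: ifP.
have none : \sum_(I in ~: (spanning true :|: spanning false)) pi I <= 1 / 2.
  rewrite pi_weight ler_pdivrMr //.
  have -> : weight (fun I => I \in ~: (spanning true :|: spanning false)) =
     weight (fun I => ~~ (spans true (val I) || spans false (val I))).
    by apply: eq_bigl => I; rewrite !inE.
  apply: le_trans (nonspanning_weight m0 mn) _; rewrite -partition_weight ler_pM2r //.
  lra.
have := slow_mixing (glauber_ge0 lambda_gt0) (glauber_sum lambda)
  (fun I => ltW (gibbs_gt0 lambda_gt0 I)) (gibbs_sum _ lambda_gt0) (glauber_reversible lambda_gt0)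
  (pos true) (pos false) (out true) (out false) none hw.
lra.
Qed.

End Conductance.

(** * Growth rate of taxi walks and conclusion *)

From mathcomp Require Import all_classical all_reals all_analysis.

Import numFieldNormedType.Exports.

Local Open Scope classical_set_scope.

(** * Fekete's lemma for submultiplicative sequences *)

Section Fekete.
Variables (R : realType) (c : nat -> nat).
Hypothesis c_gt0 : forall m, (0 < c m)%N.
Hypothesis c_mul : forall k m, (c (k + m) <= c k * c m)%N.

Let u (m : nat) : R := (c m)%:R `^ (m%:R^-1).

Lemma root_ge1 m : 1 <= u m.
Proof.
have <- : 1 `^ (m%:R^-1) = 1 :> R by rewrite powR1.
apply: ge0_ler_powR; rewrite ?nnegrE ?invr_ge0 ?ler0n //.
by rewrite ler1n.
Qed.

Lemma root_expn m : (0 < m)%N -> u m ^+ m = (c m)%:R.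
Proof.
move=> m0; rewrite /u -powR_mulrn ?powR_ge0 // -powRrM mulVf ?pnatr_eq0 -?lt0n //.
by rewrite powRr1 ?ler0n.
Qed.

Lemma submul_iter k q r : (c (q * k + r) <= c k ^ q * c r)%N.
Proof.
elim: q => [|q IH]; first by rewrite mul0n add0n expn0 mul1n.
by rewrite mulSn -addnA expnS -mulnA; apply: leq_trans (c_mul _ _) _; rewrite leq_mul2l IH orbT.
Qed.

(** Divide [m] by [k]: [B] bounds the contribution of the remainder, and [u k >= 1] allows the
    exponent to be raised from a multiple of [k] to [m]. *)
Lemma submul_growth k : (0 < k)%N ->
  exists2 B : R, 0 < B & forall m, (c m)%:R <= B * u k ^+ m.
Proof.
move=> k0; exists (\sum_(r < k) (c r)%:R).
  rewrite (bigD1 (Ordinal k0)) //= ltr_pwDl ?ltr0n ?sumr_ge0 // => i _.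
move=> m; have := submul_iter k (m %/ k) (m %% k).
rewrite -divn_eq -(ler_nat R) => /le_trans; apply.
rewrite natrM natrX mulrC -(root_expn k0) -exprM.
apply: ler_pM => //; first by rewrite exprn_ge0 // powR_ge0.
  rewrite (bigD1 (Ordinal (ltn_pmod m k0))) //= lerDl sumr_ge0 // => i _.
by apply: ler_weXn2l; rewrite ?root_ge1 // mulnC leq_divM.
Qed.

Lemma root_le_growth (B x : R) m : (0 < m)%N -> 0 < B -> 0 <= x ->
  (c m)%:R <= B * x ^+ m -> u m <= B `^ (m%:R^-1) * x.
Proof.
move=> m0 B0 x0 h.
apply: (@le_trans _ _ ((B * x ^+ m) `^ (m%:R^-1))).
  by apply: ge0_ler_powR; rewrite ?nnegrE ?invr_ge0 ?ler0n ?mulr_ge0 ?exprn_ge0 ?(ltW B0).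
rewrite powRM ?exprn_ge0 ?(ltW B0) //.
rewrite -powR_mulrn // -powRrM mulfV ?pnatr_eq0 -?lt0n // powRr1 //.
Qed.

Lemma cvg_root_const (B : R) : 0 < B ->
  (fun m : nat => B `^ (m%:R^-1)) @ \oo --> (1 : R).
Proof.
move=> B0.
rewrite -cvg_shiftS.
have -> : [sequence B `^ (m.+1%:R^-1)]_m = (fun m : nat => expR (ln B * harmonic m)).
  by apply/funext => m; rewrite /powR gt_eqF // mulrC.
have h : (fun m : nat => ln B * harmonic m) @ \oo --> ln B * 0.
  by apply: cvgMl_tmp; exact: cvg_harmonic.
have := cvg_comp _ expR h (@continuous_expR R _).
by rewrite mulr0 expR0.
Qed.

Let E := [set u k | k in [set k | (0 < k)%N]].

Lemma has_inf_roots : has_inf E.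
Proof.
split; first by exists (u 1); exists 1%N.
by exists 0 => _ [k _ <-]; rewrite powR_ge0.
Qed.

Lemma inf_root_le k : (0 < k)%N -> inf E <= u k.
Proof. by move=> k0; apply: ge_inf; [case: has_inf_roots | exists k]. Qed.

(** Once [u k < inf E + e], the growth bound gives [u m] at most [u k] times the [m]-th root of a
    constant, and that root tends to 1. *)
Lemma fekete : u @ \oo --> inf E.
Proof.
apply/cvgrPdist_lt => e e0.
have [_ [k k0 <-] hk] := inf_adherent e0 has_inf_roots.
have [B B0 hB] := submul_growth k0.
have cv : (fun m : nat => B `^ (m%:R^-1) * u k) @ \oo --> 1 * u k.
  by apply: cvgM; [exact: cvg_root_const | exact: cvg_cst].
rewrite mul1r in cv; have {}cv : \forall m \near \oo, B `^ (m%:R^-1) * u k < inf E + e.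
  by apply: (cvgr_lt (u k)).
near=> m.
have m0 : (0 < m)%N by near: m; exists 1%N.
have h1 : u m <= B `^ (m%:R^-1) * u k by apply: root_le_growth; rewrite ?powR_ge0.
have h2 : B `^ (m%:R^-1) * u k < inf E + e by near: m.
have h3 := inf_root_le m0.
by rewrite distrC ger0_norm ?subr_ge0 // ltrBlDl (le_lt_trans h1).
Unshelve. all: by end_near. Qed.

Lemma lim_root : limn u = inf E.
Proof. by apply: cvg_lim => //; exact: fekete. Qed.

Lemma growth_gt_lim x : limn u < x ->
  exists2 B : R, 0 < B & forall m, (c m)%:R <= B * x ^+ m.
Proof.
rewrite lim_root => hx.
have e0 : 0 < x - inf E by rewrite subr_gt0.
have [_ [k k0 <-] hk] := inf_adherent e0 has_inf_roots.
rewrite addrC subrK in hk.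
have [B B0 hB] := submul_growth k0; exists B => // m.
apply: le_trans (hB m) _; rewrite ler_pM2l //.
by apply: lerXn2r; rewrite ?nnegrE ?powR_ge0 ?(le_trans (powR_ge0 _ _) (ltW hk)) // ltW.
Qed.

Lemma le_lim_root x : (forall k, (0 < k)%N -> x <= u k) -> x <= limn u.
Proof.
move=> h; rewrite lim_root; apply: lb_le_inf; first by case: has_inf_roots.
by move=> _ [k k0 <-]; exact: h.
Qed.

End Fekete.

Lemma taxi_growth (R : realType) (x : R) : taxi_constant R < x ->
  exists2 B : R, 0 < B & forall m, (taxi_count m)%:R <= B * x ^+ m.
Proof. exact: (growth_gt_lim taxi_count_gt0 taxi_count_submul). Qed.

(** This follows from [2 ^ k <= taxi_count (2 * k) <= taxi_count k ^ 2]. *)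
Lemma taxi_constant_ge (R : realType) : Num.sqrt 2 <= taxi_constant R.
Proof.
apply: (le_lim_root taxi_count_gt0 taxi_count_submul) => k k0.
have h : (2 ^ k)%:R <= (taxi_count k ^ 2)%:R :> R.
  rewrite ler_nat; apply: leq_trans (taxi_count_ge k) _.
  by rewrite mul2n -addnn -mulnn taxi_count_submul.
rewrite natrX natrX -(@root_expn R taxi_count k k0) -exprM in h.
rewrite mulnC exprM in h.
have u0 : 0 <= (taxi_count k)%:R `^ (k%:R^-1) :> R by exact: powR_ge0.
rewrite -(ler_pXn2r (n := 2)) ?nnegrE ?sqrtr_ge0 // sqr_sqrtr //.
rewrite -(ler_pXn2r (n := k)) ?nnegrE ?exprn_ge0 //.
Qed.

Local Close Scope classical_set_scope.

(** * Elementary estimates for the final constants *)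

Lemma polynomial_le_expR (R : realType) (delta : R) (n k : nat) : 0 < delta ->
  n%:R ^+ k <= (delta ^+ k)^-1 * expR (k%:R * delta * n%:R).
Proof.
move=> d0; rewrite mulrC ler_pdivlMr ?exprn_gt0 // -exprMn -mulrA mulrC mulrC expRM_natl.
have h : delta * n%:R <= expR (delta * n%:R).
  by apply: le_trans (expR_ge1Dx _); rewrite lerDr.
rewrite (mulrC n%:R); apply: lerXn2r => //; rewrite nnegrE ?expR_ge0 //.
by rewrite mulr_ge0 // ltW.
Qed.

(** For large [n] the decay of [rho ^+ (n %/ 4)] absorbs the polynomial factor; for the finitely
    many other [n], [t >= 2] suffices once [c] is small. *)
Lemma exponential_lower_bound (R : realType) (D rho : R) : 0 < D -> 0 < rho -> rho < 1 ->
  exists2 c : R, 0 < c & forall n t : nat, (2 <= t)%N ->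
    ((4 <= n)%N -> 1 <= t%:R * (D * n%:R ^+ 4 * rho ^+ (n %/ 4))) -> expR (c * n%:R) <= t%:R.
Proof.
move=> D0 r0 r1.
have [a a0 E] : exists2 a : R, 0 < a & rho = expR (- a).
  exists (- ln rho); first by rewrite oppr_gt0 ln_lt0 // r0.
  by rewrite opprK lnK // posrE.
(* With this rate [n ^ 4] costs a factor [expR (a / 8 * n)], half of the decay rate [a / 4] of the
   power of [rho]; another [a / 16] will absorb [D']. *)
pose d := a / 32.
have d0 : 0 < d by rewrite divr_gt0.
pose D' := D / (d ^+ 4 * rho).
have D'0 : 0 < D' by rewrite divr_gt0 // mulr_gt0 // exprn_gt0.
(* Beyond [N] both [D' <= expR (a / 16 * n)] and [4 <= n] hold. *)
pose N : R := `|16 * ln D' / a| + 4.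
have N0 : 0 < N by rewrite /N; have := normr_ge0 (16 * ln D' / a); lra.
have ln20 : 0 < ln 2 :> R by rewrite ln_gt0 //; lra.
exists (Num.min (a / 16) (ln 2 / N)).
  by rewrite lt_min !divr_gt0.
move=> n t t2 h.
have n0 : 0 <= n%:R :> R by rewrite ler0n.
have [nN|nN] := leP n%:R N.
  apply: (@le_trans _ _ (expR (ln 2))); last by rewrite lnK ?posrE // ler_nat.
  rewrite ler_expR; apply: (@le_trans _ _ (ln 2 / N * n%:R)).
    by rewrite ler_wpM2r // ge_min lexx orbT.
  by rewrite -mulrA ler_piMr ?(ltW ln20) // mulrC ler_pdivrMr // mul1r.
have n4 : (4 <= n)%N.
  by rewrite -(ler_nat R); have := normr_ge0 (16 * ln D' / a); rewrite /N in nN; lra.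
have hD : D' <= expR (a / 16 * n%:R).
  rewrite -[leLHS]lnK ?posrE // ler_expR.
  have : 16 * ln D' / a <= n%:R by have := ler_norm (16 * ln D' / a); rewrite /N in nN; lra.
  by rewrite ler_pdivrMr //; lra.
(* Rounding in [n %/ 4] loses at most 3/4 in the exponent, less than one factor of [rho]. *)
have hrho : rho ^+ (n %/ 4) <= rho^-1 * expR (- (a / 4 * n%:R)).
  rewrite E -expRN opprK -expRM_natl -expRD ler_expR.
  have : (n%:R <= 4 * (n %/ 4)%:R + 3 :> R).
    by rewrite -natrM -natrD ler_nat; clear; lia.
  move=> hn; have := ler_wpM2l (ltW a0) hn; lra.
have hn4 := polynomial_le_expR n 4 d0.
have bound : D * n%:R ^+ 4 * rho ^+ (n %/ 4) <= D' * expR (- (a / 8 * n%:R)).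
  apply: (@le_trans _ _ (D * ((d ^+ 4)^-1 * expR (4%:R * d * n%:R)) * (rho^-1 * expR (- (a / 4 * n%:R))))).
    apply: ler_pM; rewrite ?mulr_ge0 ?exprn_ge0 ?(ltW D0) ?(ltW r0) //.
    by rewrite ler_pM2l.
  have -> : - (a / 8 * n%:R) = 4%:R * d * n%:R + - (a / 4 * n%:R).
    by rewrite /d; lra.
  have AC (x p q e1 e2 : R) : x * (p * e1) * (q * e2) = x * (p * q) * (e1 * e2).
    by ring.
  rewrite AC -expRD -invfM -/D'.
  exact: lexx.
have t0 : 0 <= t%:R :> R by rewrite ler0n.
have h2 := le_trans (h n4) (ler_wpM2l t0 bound).
have h3 : 1 <= t%:R * expR (- (a / 16 * n%:R)).
  apply: le_trans h2 _; rewrite ler_wpM2l //.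
  apply: (@le_trans _ _ (expR (a / 16 * n%:R) * expR (- (a / 8 * n%:R)))).
    by rewrite ler_wpM2r // expR_ge0.
  by rewrite -expRD ler_expR; lra.
rewrite expRN ler_pdivlMr ?expR_gt0 // mul1r in h3.
apply: le_trans h3; rewrite ler_expR ler_wpM2r // ge_min lexx //.
Qed.

(** With [c = min (b / a) (sqrt b)] the two strict bounds say [mu ^+ 2 < c]. Take [s] in between,
    [M ^+ 2 = s] and [rho ^+ 2 = s / c]: then [M ^+ 2 = c * rho ^+ 2], while [c * a <= b] and
    [c ^+ 2 <= b]. *)
Lemma exists_slack (R : realType) (mu a b : R) : 1 <= mu -> 0 < a -> 0 < b ->
  mu ^+ 2 * a < b -> mu ^+ 4 < b ->
  exists M rho : R, [/\ mu < M, 0 < rho, rho < 1, M ^+ 2 * a <= rho ^+ 2 * b &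
    M ^+ 4 <= rho ^+ 4 * b].
Proof.
move=> mu1 a0 b0 h1 h2.
pose c := Num.min (b / a) (Num.sqrt b).
have c0 : 0 < c by rewrite lt_min divr_gt0 // sqrtr_gt0.
have muc : mu ^+ 2 < c.
  rewrite lt_min ltr_pdivlMr // h1 /=.
  rewrite -(ltr_pXn2r (n := 2)) ?nnegrE ?sqrtr_ge0 ?sqr_ge0 //.
  by rewrite sqr_sqrtr ?(ltW b0) // -exprM.
have mu20 : 0 < mu ^+ 2 by rewrite exprn_gt0 // (lt_le_trans ltr01).
have [s mus sc] : exists2 s, mu ^+ 2 < s & s < c by exists ((mu ^+ 2 + c) / 2); lra.
have s0 : 0 < s by apply: lt_trans mus.
have sM : Num.sqrt s ^+ 2 = s by rewrite sqr_sqrtr // ltW.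
have sr : Num.sqrt (s / c) ^+ 2 = s / c by rewrite sqr_sqrtr // divr_ge0 // ltW.
have ca : c * a <= b by rewrite -ler_pdivlMr // ge_min lexx.
have cb : c ^+ 2 <= b.
  rewrite -[leRHS](sqr_sqrtr (ltW b0)); apply: lerXn2r; rewrite ?nnegrE ?sqrtr_ge0 ?(ltW c0) //.
  by rewrite ge_min lexx orbT.
exists (Num.sqrt s), (Num.sqrt (s / c)); split.
- rewrite -(ltr_pXn2r (n := 2)) ?nnegrE ?sqrtr_ge0 ?(le_trans ler01) // sM //; exact: mus.
- by rewrite sqrtr_gt0 divr_gt0.
- rewrite -(ltr_pXn2r (n := 2)) ?nnegrE ?sqrtr_ge0 ?ler01 // sr expr1n.
  by rewrite ltr_pdivrMr // mul1r.
- by rewrite sM sr -mulrA ler_pM2l // mulrC ler_pdivlMr // mulrC.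
- rewrite (exprM (Num.sqrt s) 2 2) sM (exprM (Num.sqrt (s / c)) 2 2) sr expr_div_n [leRHS]mulrAC.
  by rewrite ler_pdivlMr ?exprn_gt0 // ler_pM2l ?exprn_gt0.
Qed.

Unset Implicit Arguments.
Set Strict Implicit.
Set Printing Implicit Defensive.

Theorem theorem4p5 (R : realType) (lambda : R)
  (lambda_gt0 : 0 < lambda)
  (h1 : 1 + lambda > taxi_constant R ^+ 4)
  (h2 : 2 * (1 + lambda) >
        taxi_constant R ^+ 2 * (1 + Num.sqrt (1 + 4 * lambda))) :
  exists2 c : R, 0 < c &
    forall n : nat, (0 < n)%N ->
      ((expR (c * n%:R))%:E <= grid_glauber_mixing_time lambda n)%E.
Proof.
(* The positive root of [x ^+ 2 = x + lambda], which is the growth rate of the hard-core weight of a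
   path. *)
pose theta := (1 + Num.sqrt (1 + 4 * lambda)) / 2.
have sq : Num.sqrt (1 + 4 * lambda) ^+ 2 = 1 + 4 * lambda by rewrite sqr_sqrtr //; lra.
have s1 : 1 <= Num.sqrt (1 + 4 * lambda).
  by rewrite -[leLHS]sqrtr1 ler_sqrt; lra.
have theta1 : 1 <= theta by rewrite /theta; lra.
have theta2 : theta ^+ 2 = theta + lambda.
  by rewrite /theta expr_div_n sqrrD sq; lra.
have mu2 := taxi_constant_ge R.
have sq2 : Num.sqrt 2 ^+ 2 = 2 :> R by rewrite sqr_sqrtr.
have sqrt2_ge1 : 1 <= Num.sqrt 2 :> R by rewrite -[leLHS]sqrtr1 ler_sqrt; lra.
have mu1 : 1 <= taxi_constant R by apply: le_trans mu2.
(* The connective constant is at least [sqrt 2], so the first hypothesis gives [1 + lambda > 4]. *)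
have lambda3 : 3 < lambda.
  have : Num.sqrt 2 ^+ 4 <= taxi_constant R ^+ 4.
    by apply: lerXn2r; rewrite ?nnegrE ?sqrtr_ge0 ?(le_trans ler01).
  by rewrite (exprM _ 2 2) sq2; lra.
have l1 : 0 < 1 + lambda by lra.
have hth : taxi_constant R ^+ 2 * theta < 1 + lambda.
  by rewrite /theta mulrA ltr_pdivrMr // mulrC; lra.
have [M [rho [muM r0 r1 M2 M4]]] :=
  exists_slack mu1 (lt_le_trans ltr01 theta1) l1 hth h1.
have M1 : 1 <= M by apply: le_trans (ltW muM).
have [B B0 growth] := taxi_growth muM.
have D0 : 0 < 512 * B * theta ^+ 2.
  have th0 : 0 < theta := lt_le_trans ltr01 theta1.
  by apply: mulr_gt0; [apply: mulr_gt0; rewrite ?ltr0n | exact: exprn_gt0].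
have [c c0 hc] := exponential_lower_bound D0 r0 r1.
exists c => // n n0; rewrite /grid_glauber_mixing_time /mixing_time.
apply/ereal_infP => _ [t /= ht <-]; rewrite lee_fin.
(* Times 0 and 1 are excluded by the start at the empty set; [t >= 2] is what covers small [n]. *)
have t2 : (2 <= t)%N.
  rewrite leqNgt; apply/negP => t1.
  have irr : irreflexive (@grid_adj n).
    by move=> u; rewrite /grid_adj /Z2_adj !subrr.
  have := not_mixed_early lambda_gt0 ((Ordinal n0, Ordinal n0) : grid n) lambda3 irr t1.
  by rewrite ltNge ht.
apply: hc => // n4.
(* For [n >= 4] the choice [m = n %/ 4] satisfies [0 < m] and [2 * m + 2 <= n]. *)
have := mixing_lower_bound lambda_gt0 theta1 theta2 M1 r0 (ltW r1) M2 M4 B0 growth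
  (m := n %/ 4) (n := n) (t := t) _ _ (ltnW t2) ht.
rewrite divn_gt0 // => /(_ n4)/(_ ltac:(move: n4; clear; lia)).
by rewrite (_ : 32 * _ = 512 * B * theta ^+ 2 * n%:R ^+ 4 * rho ^+ (n %/ 4)) //; ring.
Qed.
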